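(* Let $f:\{-1,1\}^n\to\mathbb{R}$ be an arbitrary function and let $X$ be sampled from an Ising model which satisfies Dobrushin's condition. Then for all $t>0$, $$\Pr\big[|f(X)-\mathbb{E}f(X)|>t\big]\le\exp\left(-c\min\left(\frac{t^2}{\|\mathbb{E}_XDf(X)\|_2^2+\max_x\|Hf(x)\|_F^2},\ \frac{t}{\max_x\|Hf(x)\|_2}\right)\right),$$ where $Df$ is the vector of discrete derivatives of $f$, $Hf$ is the $n\times n$ matrix of second discrete derivatives of $f$, and $c>0$ is a constant depending only on the Dobrushin coefficient $\alpha$ of the model and on a lower bound $\gamma>0$ on the conditional variances $\mathrm{Var}(X_i\mid X_{-i})$.
   Context: An Ising model with interaction matrix $J$ (real, symmetric $n\times n$, zero diagonal) and external field $h\in\mathbb{R}^n$ is the distribution on $\{-1,1\}^n$ with $\Pr[x]\propto\exp(x^\top Jx/2+h^\top x)$. Let $\|J\|_\infty=\max_i\sum_j|J_{ij}|$. The model satisfies Dobrushin's condition if $\alpha:=\|J\|_\infty<1$; $\alpha$ is called the Dobrushin coefficient. $X_{-i}$ denotes all coordinates of $X$ except the $i$-th. The discrete derivative is $D_if(x)=(f(x_{i+})-f(x_{i-}))/2$, where $x_{i+}$ and $x_{i-}$ are obtained from $x$ by replacing $x_i$ with $1$ and $-1$ respectively; $Df(x)=(D_1f(x),\dots,D_nf(x))$ and $(Hf(x))_{ij}=D_i(D_jf)(x)$. $\|\cdot\|_2$ is the Euclidean norm on vectors and the spectral norm on matrices, $\|\cdot\|_F$ the Frobenius norm; a quotient with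 zero denominator is read as $+\infty$.
   Formalization: The bound is proved with a factor 2 in front of the exponential; without it the inequality is false, e.g. for n=1, J=0, h=0, f(x)=x_1 and 0<t<1, where the left side is 1 and the right side is exp(-ct^2)<1. *)

(* Defs.v *)
(* MathComp-Analysis *)
From HB Require Import structures.
From mathcomp Require Import all_boot all_order all_algebra.
From mathcomp Require Import boolp classical_sets reals constructive_ereal.
From mathcomp Require Import sequences exp.

Set Implicit Arguments.
Unset Strict Implicit.
Unset Printing Implicit Defensive.

Import Order.TTheory GRing.Theory Num.Theory.
Local Open Scope ring_scope.

(* A point of {-1,1}^n; [true] stands for the spin 1, [false] for -1. *)
Definition config (n : nat) := {ffun 'I_n -> bool}.

Definition spin {R : realType} {n : nat} (x : config n) : 'cV[R]_n :=
  \col_i (if x i then 1 else -1).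

Section FiniteProbability.
Context {R : realType} {T : finType}.
Implicit Types (p g : T -> R) (A : pred T).

Definition prob p A : R := \sum_(x | A x) p x.

Definition expect p g : R := \sum_x p x * g x.

(* Elementary conditioning, meaningful when [prob p A] is nonzero. *)
Definition cond_expect p A g : R := (\sum_(x | A x) p x * g x) / prob p A.

Definition cond_var p A g : R :=
  cond_expect p A (fun x => (g x - cond_expect p A g) ^+ 2).

End FiniteProbability.

Section Norms.
Context {R : realType}.

Definition norm2 {n : nat} (v : 'cV[R]_n) : R :=
  Num.sqrt (\sum_i v i 0 ^+ 2).

Definition frobenius_norm {m n : nat} (A : 'M[R]_(m, n)) : R :=
  Num.sqrt (\sum_i \sum_j A i j ^+ 2).

Definition spectral_norm {m n : nat} (A : 'M[R]_(m, n)) : R :=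
  sup [set norm2 (A *m v) | v in [set v : 'cV[R]_n | norm2 v <= 1]]%classic.

(* The base value 0 only matters for n = 0, all row sums being nonnegative. *)
Definition inf_norm {n : nat} (A : 'M[R]_n) : R :=
  \big[Num.max/0]_i \sum_j `|A i j|.

End Norms.

Section Ising.
Context {R : realType} {n : nat}.
Implicit Types (J : 'M[R]_n) (h : 'cV[R]_n) (x : config n) (i : 'I_n).

Definition ising_weight J h x : R :=
  expR (((spin x)^T *m J *m spin x) 0 0 / 2 + (h^T *m spin x) 0 0).

Definition ising J h x : R :=
  ising_weight J h x / \sum_y ising_weight J h y.

(* The event X_{-i} = x_{-i}. *)
Definition agree_off i x : pred (config n) :=
  fun y => [forall j, (j != i) ==> (y j == x j)].

(* Var(X_i | X_{-i} = x_{-i}); every such event has positive probability under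
   an Ising model. *)
Definition ising_cond_var J h i x : R :=
  cond_var (ising J h) (agree_off i x) (fun y => spin y i 0).

End Ising.

Section DiscreteDerivatives.
Context {R : realType} {n : nat}.
Implicit Types (f : config n -> R) (x : config n) (i : 'I_n).

Definition set_coord x i (b : bool) : config n :=
  [ffun j => if j == i then b else x j].

Definition D i f : config n -> R :=
  fun x => (f (set_coord x i true) - f (set_coord x i false)) / 2.

Definition gradient f x : 'cV[R]_n := \col_i D i f x.

Definition hessian f x : 'M[R]_n := \matrix_(i, j) D i (D j f) x.

Definition expect_gradient (p : config n -> R) f : 'cV[R]_n :=
  \col_i expect p (fun x => gradient f x i 0).

(* In these two maxima the base value 0 is harmless: the values are nonnegative
   and [config n] is nonempty. *)
Definition max_hessian_frobenius_sq f : R :=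
  \big[Num.max/0]_x frobenius_norm (hessian f x) ^+ 2.

Definition max_hessian_spectral f : R :=
  \big[Num.max/0]_x spectral_norm (hessian f x).

End DiscreteDerivatives.

(* Main.v *)
Require Import Defs.
From mathcomp Require Import all_boot all_order all_algebra.
From mathcomp Require Import boolp classical_sets reals constructive_ereal.
From mathcomp Require Import functions topology normedtype derive realfun.
From mathcomp Require Import sequences exp.
From mathcomp Require Import fintype finset.
From mathcomp Require Import ring lra.

(** The proof has two halves: a Poincare and a logarithmic Sobolev inequality for
the Ising model, and a concentration argument that uses only these two
functional inequalities.

For the functional inequalities, variance and entropy are decomposed along
blocks of spins. For a block [S] and [i] in [S], the variance (or entropy) of
[g] over [S] is its mean over [S :\ i] plus the variance (entropy) of the
marginal [E (S :\ i) g], a function of the single spin [i]. For the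
variance, that remainder is the squared covariance of [g] with the spin [i]
divided by the variance of that spin, which is at least [gamma]
([var_marginal_le]); for the entropy it is at most the same quantity divided
by the mean of [g] ([ent_le_var]).
Dobrushin's condition bounds the sum of these squared covariances
([sum_sqr_cov_spin_le]): heat-bath dynamics contracts Lipschitz constants at
rate [1 - alpha], so that covariances are controlled by single-site slopes of
[g] ([dobrushin_cov]). Averaging over [i] and induction on the block
([tensorization]) yield [poincare] and [log_sobolev] with constants
[C0 = (gamma * (1 - alpha) ^+ 2)^-1] and [4 * C0]. The energy in [log_sobolev]
involves only the decrements of [f] along flips.

For the concentration, let [W] be the squared length of the discrete gradient
of [f]. The decrements of [W] are controlled by the Hessian applied to
the gradient, so the one-sided energy of [W] is at most [16 * L ^+ 2 * W], where
[L] bounds the spectral norm of the Hessian. Herbst's argument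
([herbst_argument]) then bounds [ln (E (expR (s * W)))] by [2 * s * E W] for
[s] up to order [L ^- 2] ([ln_laplace_grad_sqr_le]). The energy of [expR (s * f)] is
at most its pairing with [4 * s ^+ 2 * W], and the variational principle for the entropy
([expect_expR_le_entropy]) trades it for those moments, so that the centred
logarithmic Laplace transform of [f] is at most of order [s ^+ 2 * E W] for [s] up
to order [L^-1] ([ln_laplace_le_second_order]). The Poincare inequality for each
partial derivative bounds [E W] by the squared mean gradient plus the Frobenius
term ([mean_grad_sqr_le]), and optimizing over [s] in the exponential Markov
inequality gives the two regimes ([optimize_tail]). *)

Set Implicit Arguments.
Unset Strict Implicit.
Unset Printing Implicit Defensive.

Import Order.TTheory GRing.Theory Num.Theory.
Import numFieldNormedType.Exports.
Local Open Scope ring_scope.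

(** * Cauchy-Schwarz and Minkowski inequalities for finite sums *)

(** The discriminant of a nonnegative quadratic, stated so that [a = 0] is
allowed. *)
Lemma le_mul_of_quadratic_ge0 (R : realFieldType) (a b c : R) :
  0 <= a -> (forall x, 0 <= a * x ^+ 2 + 2 * b * x + c) -> b ^+ 2 <= a * c.
Proof.
rewrite le_eqVlt => /predU1P[<- q_ge0|a_gt0 q_ge0]; last first.
  have := q_ge0 (- b / a).
  have -> : a * (- b / a) ^+ 2 + 2 * b * (- b / a) + c = c - b ^+ 2 / a.
    by field; rewrite gt_eqF.
  by rewrite subr_ge0 ler_pdivrMr// mulrC.
have [->|b_neq0] := eqVneq b 0; first by rewrite expr0n mul0r.
have := q_ge0 (- (c + 1) / (2 * b)).
have -> : 0 * (- (c + 1) / (2 * b)) ^+ 2 + 2 * b * (- (c + 1) / (2 * b)) + c = -1.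
  by field.
by rewrite ler0N1.
Qed.

Lemma sum_cauchy_schwarz (R : realFieldType) (I : finType) (P : pred I)
    (w u v : I -> R) : (forall i, P i -> 0 <= w i) ->
  (\sum_(i | P i) w i * (u i * v i)) ^+ 2 <=
  (\sum_(i | P i) w i * u i ^+ 2) * (\sum_(i | P i) w i * v i ^+ 2).
Proof.
move=> w_ge0; apply: le_mul_of_quadratic_ge0 => [|x].
  by apply: sumr_ge0 => i Pi; rewrite mulr_ge0 ?w_ge0 ?sqr_ge0.
rewrite (_ : _ + _ = \sum_(i | P i) w i * (x * u i + v i) ^+ 2).
  by apply: sumr_ge0 => i Pi; rewrite mulr_ge0 ?w_ge0 ?sqr_ge0.
rewrite mulr_sumr !mulr_suml -!big_split/=; apply: eq_bigr => i _; ring.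
Qed.

Lemma sum_cauchy_schwarz_sqrt (R : rcfType) (I : finType) (P : pred I)
    (u v : I -> R) :
  `|\sum_(i | P i) u i * v i| <=
  Num.sqrt (\sum_(i | P i) u i ^+ 2) * Num.sqrt (\sum_(i | P i) v i ^+ 2).
Proof.
rewrite -sqrtrM; last by apply: sumr_ge0 => i _; exact: sqr_ge0.
rewrite -sqrtr_sqr ler_sqrt; last first.
  by rewrite mulr_ge0// sumr_ge0// => i _; exact: sqr_ge0.
have := @sum_cauchy_schwarz R I P (fun=> 1) u v (fun i _ => ler01).
by under eq_bigr do rewrite mul1r; under [X in _ <= X * _]eq_bigr do rewrite mul1r;
   under [X in _ <= _ * X]eq_bigr do rewrite mul1r.
Qed.

Lemma sum_minkowski (R : rcfType) (I : finType) (P : pred I) (u v : I -> R) :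
  Num.sqrt (\sum_(i | P i) (u i + v i) ^+ 2) <=
  Num.sqrt (\sum_(i | P i) u i ^+ 2) + Num.sqrt (\sum_(i | P i) v i ^+ 2).
Proof.
have ge0 w : 0 <= \sum_(i | P i) w i ^+ 2 :> R.
  by apply: sumr_ge0 => i _; exact: sqr_ge0.
rewrite -[leRHS]ger0_norm ?addr_ge0 ?sqrtr_ge0//.
rewrite -sqrtr_sqr ler_sqrt ?sqr_ge0// sqrrD !sqr_sqrtr//.
rewrite (_ : \sum_(i | P i) _ = \sum_(i | P i) u i ^+ 2
  + 2 * (\sum_(i | P i) u i * v i) + \sum_(i | P i) v i ^+ 2); last first.
  by rewrite mulr_sumr -!big_split/=; apply: eq_bigr => i _; ring.
rewrite -[X in _ <= _ + X + _]mulr_natl lerD2r lerD2l ler_pM2l//.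
exact: le_trans (ler_norm _) (sum_cauchy_schwarz_sqrt _ _ _).
Qed.

(** * Laplace transforms and Herbst's argument *)

(** Inverting [1 - x <= expR (- x)] gives [expR x <= (1 - x)^-1], and the right-hand
side times [1 - x] is [1 + x ^+ 2 * (1 - 2 * x)]. *)
Lemma expR_le_quadratic (R : realType) (x : R) :
  x <= 1 / 2 -> expR x <= 1 + x + 2 * x ^+ 2.
Proof.
move=> x_le; have /= := expR_ge1Dx (- x).
rewrite expRN -ler_pV2 ?inE ?unitfE ?invrK; last 2 first.
- by rewrite invr_eq0 gt_eqF ?invr_gt0 expR_gt0.
- by rewrite gt_eqF /=; lra.
move/le_trans; apply.
rewrite -[leLHS]mul1r ler_pdivrMr; [nra|lra].
Qed.

Section Laplace.
Context {R : realType} {T : finType} (p a : T -> R).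
Hypothesis p_ge0 : forall x, 0 <= p x.
Hypothesis p_sum1 : \sum_x p x = 1.

Definition laplace (s : R) : R := expect p (fun x => expR (s * a x)).

Definition laplace_deriv (s : R) : R := expect p (fun x => a x * expR (s * a x)).

Lemma is_derive_laplace (s : R) : is_derive s 1 laplace (laplace_deriv s).
Proof.
rewrite /laplace_deriv /expect.
have -> : laplace = \sum_x (fun s : R => p x * expR (s * a x)).
  by apply/funext => r; rewrite fct_sumE.
elim/big_ind2 : _ => [|f df g dg ? ?|x _]; first exact: is_derive_cst.
  exact: is_deriveD.
have -> : (fun s : R => p x * expR (s * a x)) =
    p x \*: (expR \o (a x \*: id)).
  by apply/funext => r; congr (_ * expR _); exact: mulrC.
apply: is_derive_eq.
by rewrite /= /GRing.scale /= mulr1 [a x * s]mulrC [expR _ * _]mulrC.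
Qed.

Lemma laplace_gt0 (s : R) : 0 < laplace s.
Proof.
rewrite lt_neqAle eq_sym; apply/andP; split; last first.
  by apply: sumr_ge0 => x _; rewrite mulr_ge0 ?expR_ge0.
apply/eqP => /eqP; rewrite /laplace /expect psumr_eq0 => [/allP Z0|x _]; last first.
  by rewrite mulr_ge0 ?expR_ge0.
suff : \sum_x p x = 0 by apply/eqP; rewrite p_sum1 oner_eq0.
apply: big1 => x _; have := Z0 x (mem_index_enum x).
by rewrite /= mulf_eq0 (gt_eqF (expR_gt0 _)) orbF => /eqP.
Qed.

(** Controls the logarithmic Laplace transform near [s = 0], where Herbst's
argument starts. *)
Lemma ln_laplace_le (s : R) : (forall x, s * a x <= 1 / 2) ->
  ln (laplace s) <= s * expect p a + 2 * s ^+ 2 * expect p (fun x => a x ^+ 2).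
Proof.
move=> sa_le; have -> : laplace s = 1 + (laplace s - 1) by ring.
apply: le_trans (le_ln1Dx _) _; first by have := laplace_gt0 s; lra.
rewrite lerBlDl -[X in _ <= X + _]p_sum1 /laplace /expect !mulr_sumr -!big_split/=.
apply: ler_sum => x _; have := expR_le_quadratic (sa_le x).
move/(ler_wpM2l (p_ge0 x)) => /le_trans; apply.
by rewrite le_eqVlt; apply/orP; left; apply/eqP; ring.
Qed.

(** Herbst's argument: the hypothesis says exactly that
[ln (laplace s) * (s^-1 - b) - K * s] has nonpositive derivative for
[0 < s <= s0], so this function is bounded by its limit at [0], which is the mean of [a].
With [b = 0] this is the classical sub-Gaussian case; [b > 0] covers entropy
bounds in which the energy is again [a] itself, as for squared gradients. *)
Lemma herbst_argument (b K s0 : R) : 0 <= b -> 0 <= K ->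
  (forall s, 0 < s <= s0 ->
    s * laplace_deriv s - laplace s * ln (laplace s)
    <= s ^+ 2 * (b * laplace_deriv s + K * laplace s)) ->
  forall s, 0 < s <= s0 ->
    ln (laplace s) * (1 - b * s) <= s * expect p a + K * s ^+ 2.
Proof.
move=> b_ge0 K_ge0 ent_le s /andP[s_gt0 s_le].
(* Instead of a limit at 0, G s <= G e is used at an e depending on the error d. *)
pose G r := ln (laplace r) * (r^-1 - b) - K * r.
pose dG (r : R) := laplace_deriv r / laplace r * (r^-1 - b)
   - ln (laplace r) / r ^+ 2 - K.
have dGP (r : R) : 0 < r -> is_derive r 1 G (dG r).
  move=> r_gt0.
  have dln := @is_derive1_ln R _ (laplace_gt0 r).
  have dL := is_derive_laplace r.
  have dlL : is_derive r 1 (@ln R \o laplace) ((laplace r)^-1 * laplace_deriv r).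
    exact: is_derive1_comp.
  have dV : is_derive r 1 (fun r : R => r^-1) (- r ^- 2 *: 1).
    by apply: is_deriveV; rewrite gt_eqF.
  have -> : G = (@ln R \o laplace) * ((fun r : R => r^-1) - cst b) - K \*: id.
    by apply/funext => u.
  apply: is_derive_eq.
  rewrite /dG /= /GRing.scale /= subr0 !mulr1 [(_ * _)%R]/=.
  rewrite !fctE; ring.
have dG_le0 r : 0 < r -> r <= s0 -> dG r <= 0.
  move=> r_gt0 r_le.
  have := ent_le r; rewrite r_gt0 r_le => /(_ isT).
  set Z := laplace r; set Z' := laplace_deriv r => ent_r.
  have Z_gt0 : 0 < Z := laplace_gt0 r.
  have -> : dG r = (r * Z' - Z * ln Z - r ^+ 2 * (b * Z' + K * Z)) / (r ^+ 2 * Z).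
    by rewrite /dG -/Z -/Z'; field; rewrite !gt_eqF.
  by rewrite mulr_le0_ge0 ?subr_le0// invr_ge0 mulr_ge0 ?sqr_ge0 ?ltW.
have G_anti e : 0 < e -> e <= s -> G s <= G e.
  move=> e_gt0; rewrite le_eqVlt => /predU1P[->//|es].
  have [||c] := @MVT R G dG e s es.
  - by move=> x; rewrite in_itv/= => /andP[ex _]; apply: dGP; exact: lt_trans ex.
  - apply: derivable_within_continuous => x; rewrite in_itv/= => /andP[ex _].
    by have [] := dGP x (lt_le_trans e_gt0 ex).
  rewrite in_itv/= => /andP[ec cs] GE.
  have c_gt0 := lt_trans e_gt0 ec.
  have dGc := dG_le0 c c_gt0 (le_trans (ltW cs) s_le).
  by rewrite -subr_le0 GE mulr_le0_ge0// subr_ge0 ltW.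
pose m := expect p a; pose Q := expect p (fun x => a x ^+ 2).
have Q_ge0 : 0 <= Q by apply: sumr_ge0 => x _; rewrite mulr_ge0 ?sqr_ge0.
have G_le : G s <= m.
  apply/ler_addgt0Pr => d d_gt0.
  pose A := \sum_x `|a x|.
  have A_ge x : a x <= A.
    apply: le_trans (ler_norm _) _.
    by rewrite /A (bigD1 x)//= lerDl sumr_ge0.
  have A_ge0 : 0 <= A by apply: sumr_ge0.
  pose B := 2 * Q + b * `|m|.
  have B_ge0 : 0 <= B by rewrite /B addr_ge0 ?mulr_ge0.
  (* M is large enough for e = 1 / M to meet four smallness conditions:
     e <= s, e * a <= 1 / 2, e * b <= 1 and e * B <= d. *)
  pose M := 1 / s + 2 * A + b + B / d.
  have M_gt0 : 0 < M.
    have : 0 < 1 / s by rewrite divr_gt0.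
    have : 0 <= B / d by rewrite divr_ge0// ltW.
    by rewrite /M; lra.
  pose e := M^-1.
  have e_gt0 : 0 < e by rewrite invr_gt0.
  have eM : e * M = 1 by rewrite /e mulVf// gt_eqF.
  have h1 : 0 <= e / s by rewrite divr_ge0 ?ltW.
  have h2 : 0 <= e * A by rewrite mulr_ge0// ltW.
  have h3 : 0 <= e * b by rewrite mulr_ge0// ltW.
  have h4 : 0 <= e * B / d by rewrite divr_ge0// ?mulr_ge0// ltW.
  have eME : e / s + 2 * (e * A) + e * b + e * B / d = 1.
    by rewrite -[RHS]eM /M; field; rewrite !gt_eqF.
  have es : e <= s by rewrite -[leRHS]mul1r -ler_pdivrMr//; lra.
  have eB : e * B <= d by rewrite -[leRHS]mul1r -ler_pdivrMr//; lra.
  apply: le_trans (G_anti e e_gt0 es) _.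
  have ln_le := @ln_laplace_le e _; rewrite -/m -/Q in ln_le.
  have {}ln_le : ln (laplace e) <= e * m + 2 * e ^+ 2 * Q.
    apply: ln_le => x; have := ler_wpM2l (ltW e_gt0) (A_ge x); lra.
  have -> : G e = ln (laplace e) / e * (1 - e * b) - K * e.
    by rewrite /G; field; rewrite gt_eqF.
  have Le : ln (laplace e) / e <= m + 2 * e * Q.
    rewrite ler_pdivrMr//; apply: le_trans ln_le _.
    by rewrite le_eqVlt; apply/orP; left; apply/eqP; ring.
  have h5 : 0 <= 1 - e * b by lra.

  have := ler_wpM2r h5 Le; have := mulr_ge0 K_ge0 (ltW e_gt0).
  have : (m + 2 * e * Q) * (1 - e * b) <= m + e * B.
    rewrite -subr_ge0 (_ : _ - _ = e * b * (`|m| + m) + e * b * (2 * e * Q)); last first.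
      by rewrite /B; ring.
    rewrite addr_ge0// ?mulr_ge0// ?(ltW e_gt0)//.
    by have := lerNnormlW (lexx `|m|); lra.
  lra.
have -> : ln (laplace s) * (1 - b * s) = s * (G s + K * s).
  by rewrite /G; field; rewrite gt_eqF.
rewrite mulrDr lerD ?ler_wpM2l ?(ltW s_gt0)//.
by rewrite le_eqVlt; apply/orP; left; apply/eqP; ring.
Qed.

End Laplace.

(** * Conditional expectations over blocks of spins *)

Section ConditionalExpectation.
Context {R : realType} {n : nat} {p : config n -> R}.
Hypothesis p_gt0 : forall x, 0 < p x.
Implicit Types (S T : {set 'I_n}) (x y z : config n) (g h u : config n -> R).

Definition same_off S x : pred (config n) :=
  fun y => [forall j, (j \notin S) ==> (y j == x j)].

Lemma same_offP S x y :
  reflect (forall j, j \notin S -> y j = x j) (same_off S x y).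
Proof.
apply: (iffP forallP) => [H j jS|H j]; first exact/eqP/(implyP (H j)).
by apply/implyP => jS; apply/eqP/H.
Qed.

Lemma same_off_refl S x : same_off S x x.
Proof. exact/same_offP. Qed.

Lemma same_off_eq S x y : same_off S x y -> same_off S y =1 same_off S x.
Proof.
move=> /same_offP xy z; apply/same_offP/same_offP => H j jS.
  by rewrite H// xy.
by rewrite H// xy.
Qed.

Lemma same_off_sym S x y : same_off S x y = same_off S y x.
Proof. by apply/same_offP/same_offP => H j /H. Qed.

Lemma same_off_sub S T x y : S \subset T -> same_off S x y -> same_off T x y.
Proof.
move=> /subsetP ST /same_offP H; apply/same_offP => j jT; apply: H.
by apply: contra jT; exact: ST.
Qed.

Lemma same_off_set0 x y : same_off set0 x y = (y == x).
Proof.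
apply/same_offP/eqP => [H|-> //]; apply/ffunP => j; apply: H.
by rewrite in_set0.
Qed.

Lemma same_off_setT x y : same_off setT x y.
Proof. by apply/same_offP => j; rewrite in_setT. Qed.

Lemma set_coordE x i b j : set_coord x i b j = if j == i then b else x j.
Proof. by rewrite ffunE. Qed.

Lemma set_coord_id x i : set_coord x i (x i) = x.
Proof. by apply/ffunP => j; rewrite ffunE; case: eqP => [->|]. Qed.

Lemma set_coordC x i j b c : i != j ->
  set_coord (set_coord x i b) j c = set_coord (set_coord x j c) i b.
Proof.
move=> ij; apply/ffunP => k; rewrite !ffunE.
by case: (eqVneq k j) => [->|//]; rewrite eq_sym (negPf ij).
Qed.

Lemma set_coord2 x i b c : set_coord (set_coord x i b) i c = set_coord x i c.
Proof. by apply/ffunP => k; rewrite !ffunE; case: eqP. Qed.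

Lemma same_off_set_coord S x i b : i \in S -> same_off S x (set_coord x i b).
Proof.
by move=> iS; apply/same_offP => j jS; rewrite ffunE; case: eqP => // ji;
  rewrite ji iS in jS.
Qed.

Lemma same_off1 x i y : same_off [set i] x y -> y = set_coord x i (y i).
Proof.
move/same_offP => H; apply/ffunP => j; rewrite ffunE; case: eqP => [->//|/eqP ji].
by rewrite H// inE.
Qed.

(** The conditional expectation of [g] given the spins outside [S], as a
function of the configuration that fixes those spins. *)
Definition CE S g x : R := cond_expect p (same_off S x) g.

Lemma prob_same_off_gt0 S x : 0 < prob p (same_off S x).
Proof.
rewrite /prob (bigD1 x) ?same_off_refl//= ltr_pwDl//.
by apply: sumr_ge0 => y _; rewrite ltW.
Qed.
Hint Resolve prob_same_off_gt0 : core.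

Lemma eq_CE S g h x : (forall y, same_off S x y -> g y = h y) ->
  CE S g x = CE S h x.
Proof. by move=> gh; congr (_ / _); apply: eq_bigr => y /gh ->. Qed.

Lemma le_CE S g h x : (forall y, same_off S x y -> g y <= h y) ->
  CE S g x <= CE S h x.
Proof.
move=> gh; apply: ler_wpM2r; first by rewrite invr_ge0 ltW.
by apply: ler_sum => y /gh; rewrite ler_pM2l.
Qed.

Lemma CE_same S g x y : same_off S x y -> CE S g y = CE S g x.
Proof.
by move=> xy; rewrite /CE /cond_expect /prob !(eq_bigl _ _ (same_off_eq xy)).
Qed.

Lemma CE_pull S u g x : (forall y, same_off S x y -> u y = u x) ->
  CE S (fun y => u y * g y) x = u x * CE S g x.
Proof.
move=> uE; rewrite /CE /cond_expect mulrA mulr_sumr; congr (_ / _).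
by apply: eq_bigr => y /uE ->; ring.
Qed.

Lemma CEZ S (k : R) g x : CE S (fun y => k * g y) x = k * CE S g x.
Proof. exact: (@CE_pull S (fun=> k)). Qed.

Lemma CE_cst S (k : R) x : CE S (fun=> k) x = k.
Proof.
rewrite /CE /cond_expect -mulr_suml mulrAC divff ?mul1r//.
by rewrite gt_eqF// prob_same_off_gt0.
Qed.

Lemma CED S g h x : CE S (fun y => g y + h y) x = CE S g x + CE S h x.
Proof.
rewrite /CE /cond_expect -mulrDl -big_split; congr (_ / _).
by apply: eq_bigr => y _; rewrite mulrDr.
Qed.

Lemma CEN S g x : CE S (fun y => - g y) x = - CE S g x.
Proof.
by rewrite -mulN1r -CEZ; apply: eq_CE => y _; rewrite mulN1r.
Qed.

Lemma CEB S g h x : CE S (fun y => g y - h y) x = CE S g x - CE S h x.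
Proof. by rewrite (CED S g (fun y => - h y)) CEN. Qed.

Lemma CE_sum S (I : finType) (P : pred I) (G : I -> config n -> R) x :
  CE S (fun y => \sum_(i | P i) G i y) x = \sum_(i | P i) CE S (G i) x.
Proof.
rewrite /CE /cond_expect -mulr_suml; congr (_ / _).
under eq_bigr do rewrite mulr_sumr.
exact: exchange_big.
Qed.

Lemma CE_ge0 S g x : (forall y, 0 <= g y) -> 0 <= CE S g x.
Proof. by move=> g0; rewrite -(CE_cst S 0 x); apply: le_CE => y _. Qed.

Lemma CE_abs S g x : `|CE S g x| <= CE S (fun y => `|g y|) x.
Proof.
rewrite ler_norml -CEN; apply/andP; split; apply: le_CE => y _.
  by rewrite lerNl -normrN ler_norm.
exact: ler_norm.
Qed.

Lemma CE_gt0 S g x : (forall y, 0 < g y) -> 0 < CE S g x.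
Proof.
move=> g0; rewrite mulr_gt0 ?invr_gt0//.
rewrite (bigD1 x) ?same_off_refl//= ltr_pwDl ?mulr_gt0//.
by apply: sumr_ge0 => y _; rewrite ltW// mulr_gt0.
Qed.

Lemma CE_set0 g x : CE set0 g x = g x.
Proof.
rewrite /CE /cond_expect /prob !(eq_bigl _ _ (same_off_set0 x)) !big_pred1_eq.
by rewrite mulrAC divff ?mul1r// gt_eqF.
Qed.

Lemma CE_setT g x : \sum_y p y = 1 -> CE setT g x = expect p g.
Proof.
move=> p1; rewrite /CE /cond_expect /prob.
under eq_bigl do rewrite same_off_setT; under [X in _ / X]eq_bigl do rewrite same_off_setT.
by rewrite p1 divr1.
Qed.

(** Averaging over the larger block absorbs averaging over the smaller one,
because the blocks of [T] partition those of [S]. *)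
Lemma CE_tower S T g x : T \subset S -> CE S (CE T g) x = CE S g x.
Proof.
move=> TS; congr (_ / _).
rewrite /CE /cond_expect.
under eq_bigr => y _ do rewrite mulr_suml mulr_sumr big_mkcond/=.
rewrite (exchange_big_dep xpredT)//= [RHS]big_mkcond/=; apply: eq_bigr => z _.
rewrite -big_mkcondr/=.
rewrite (eq_bigl (fun y => same_off S x z && same_off T z y)); last first.
  move=> y; rewrite [same_off T z y]same_off_sym.
  case: (boolP (same_off T y z)) => zy; rewrite ?andbT ?andbF//.
  by rewrite same_off_sym [RHS]same_off_sym (same_off_eq (same_off_sub TS zy)).
case: ifP => _; last by rewrite big_pred0.
have N0 : prob p (same_off T z) != 0 by rewrite gt_eqF.
transitivity ((\sum_(y | same_off T z y) p y) * (p z * g z) / prob p (same_off T z)).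
  rewrite !mulr_suml; apply: eq_bigr => y /= zy; rewrite /prob.
  rewrite (eq_bigl _ _ (same_off_eq zy)) -/(prob p (same_off T z)); ring.
by rewrite -/(prob p (same_off T z)); field.
Qed.

Lemma CE_cauchy_schwarz S g h x :
  CE S (fun y => g y * h y) x ^+ 2 <=
  CE S (fun y => g y ^+ 2) x * CE S (fun y => h y ^+ 2) x.
Proof.
have := @sum_cauchy_schwarz R _ (same_off S x) p g h (fun y _ => ltW (p_gt0 y)).
set P := prob p (same_off S x).
have P2 : 0 <= P^-1 ^+ 2 by rewrite sqr_ge0.
by move/(ler_wpM2r P2); rewrite -exprMn expr2 [X in _ <= X -> _]mulrACA.
Qed.

Definition cov S g h x : R :=
  CE S (fun y => g y * h y) x - CE S g x * CE S h x.

Lemma covC S g h x : cov S g h x = cov S h g x.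
Proof.
by rewrite /cov mulrC; congr (_ - _); apply: eq_CE => y _; rewrite mulrC.
Qed.

Lemma eq_cov S g g' h h' x : (forall y, same_off S x y -> g y = g' y) ->
  (forall y, same_off S x y -> h y = h' y) -> cov S g h x = cov S g' h' x.
Proof.
move=> gE hE; rewrite /cov (eq_CE gE) (eq_CE hE); congr (_ - _).
by apply: eq_CE => y xy; rewrite gE// hE.
Qed.

Lemma covDr S g h u x : cov S g (fun y => h y + u y) x = cov S g h x + cov S g u x.
Proof.
rewrite /cov CED (eq_CE (h := fun y => g y * h y + g y * u y)) => [|y _].
  by rewrite CED; ring.
by rewrite mulrDr.
Qed.

Lemma covZr S g (k : R) h x : cov S g (fun y => k * h y) x = k * cov S g h x.
Proof.
rewrite /cov CEZ (eq_CE (h := fun y => k * (g y * h y))) => [|y _].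
  by rewrite CEZ; ring.
ring.
Qed.

Lemma cov_cstr S g (k : R) x : cov S g (fun=> k) x = 0.
Proof.
rewrite /cov CE_cst (eq_CE (h := fun y => k * g y)) => [|y _]; last ring.
by rewrite CEZ; ring.
Qed.

Lemma cov_sumr S g (I : finType) (P : pred I) (H : I -> config n -> R) x :
  cov S g (fun y => \sum_(i | P i) H i y) x = \sum_(i | P i) cov S g (H i) x.
Proof.
rewrite /cov CE_sum mulr_sumr sumrB -CE_sum.
by congr (_ - _); apply: eq_CE => y _; rewrite mulr_sumr.
Qed.

Lemma CE_pull_CE S T g h x : T \subset S ->
  CE S (fun y => CE T g y * h y) x = CE S (fun y => CE T g y * CE T h y) x.
Proof.
move=> TS; rewrite -(CE_tower _ _ TS); apply: eq_CE => y _.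
by rewrite CE_pull// => z; exact: CE_same.
Qed.

(** The law of total covariance. *)
Lemma cov_tower S T g h x : T \subset S ->
  cov S g h x = CE S (cov T g h) x + cov S (CE T g) (CE T h) x.
Proof. by move=> TS; rewrite /cov CEB !CE_tower//; ring. Qed.

Lemma cov_CE S T g h x : T \subset S ->
  cov S g (CE T h) x = cov S (CE T g) (CE T h) x.
Proof.
move=> TS; rewrite /cov !CE_tower//; congr (_ - _).
transitivity (CE S (fun y => CE T h y * g y) x).
  by apply: eq_CE => y _; rewrite mulrC.
by rewrite CE_pull_CE//; apply: eq_CE => y _; rewrite mulrC.
Qed.

Lemma var_ge0 S g x : 0 <= cov S g g x.
Proof.
have := CE_cauchy_schwarz S g (fun=> 1) x; rewrite /cov subr_ge0 expr1n CE_cst mulr1.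
by under eq_CE do rewrite mulr1.
Qed.

End ConditionalExpectation.

Arguments CE {R n} p S g x.
Arguments cov {R n} p S g h x.

(** * Covariances under Dobrushin's condition *)

Section Dobrushin.
Context {R : realType} {n : nat} {p : config n -> R}.
Hypothesis p_gt0 : forall x, 0 < p x.
Implicit Types (S T : {set 'I_n}) (x y z : config n) (g h u f : config n -> R).
Implicit Types (i j k : 'I_n) (c : 'I_n -> R).

Local Notation E := (CE p).

Definition up_prob i : config n -> R := E [set i] (fun y => (y i)%:R).

Lemma CE_set1 i g x :
  E [set i] g x =
  up_prob i x * g (set_coord x i true) + (1 - up_prob i x) * g (set_coord x i false).
Proof.
rewrite (eq_CE (h := fun y => g (set_coord x i true) * (y i)%:R +
   (g (set_coord x i false) - g (set_coord x i false) * (y i)%:R))).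
  by rewrite CED CEB// !CEZ CE_cst// -/(up_prob i x); ring.
move=> y /same_off1 ->; rewrite set_coordE eqxx.
by case: (y i) => /=; ring.
Qed.

Lemma up_prob_ge0 i x : 0 <= up_prob i x.
Proof. by apply: CE_ge0 => // y; rewrite ler0n. Qed.

Lemma up_prob_le1 i x : up_prob i x <= 1.
Proof.
rewrite -(CE_cst p_gt0 [set i] 1 x); apply: le_CE => // y _.
by case: (y i).
Qed.

Lemma up_prob_set_coord i b x : up_prob i (set_coord x i b) = up_prob i x.
Proof. by apply: CE_same; apply: same_off_set_coord; rewrite inE. Qed.

(** Resampling the spin [i] has conditional variance [4 * (v * (1 - v))] with
[v = up_prob i x], so this is that variance times [`|D i g x|]: the rate at
which [g] correlates with the spin [i] when all other spins are fixed. *)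
Definition local_slope i g x : R :=
  2 * (up_prob i x * (1 - up_prob i x)) * `|g (set_coord x i true) - g (set_coord x i false)|.

Lemma local_slope_ge0 i g x : 0 <= local_slope i g x.
Proof.
have := up_prob_ge0 i x; have := up_prob_le1 i x; rewrite /local_slope -subr_ge0.
by move: (up_prob i x) => u u1 u0; rewrite !mulr_ge0.
Qed.

(** [f - E [set i] f] averages to zero over the spin [i], so only the variation
of [g] in that single spin contributes. *)
Lemma cov_local S i g f x (c : R) : i \in S -> (forall z, `|D i f z| <= c) ->
  `|cov p S g (fun y => f y - E [set i] f y) x| <= E S (local_slope i g) x * c.
Proof.
move=> iS Df; have iS1 : [set i] \subset S by rewrite sub1set.
rewrite /cov CEB// CE_tower// subrr mulr0 subr0 -(CE_tower p_gt0 _ _ iS1).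
apply: le_trans (CE_abs p_gt0 _ _ _) _.
rewrite [leRHS]mulrC -CEZ; apply: le_CE => // y _.
rewrite !CE_set1 !up_prob_set_coord !set_coord2 /local_slope.
set v := up_prob i y; set g1 := g _; set g0 := g _; set f1 := f _; set f0 := f _.
have v0 : 0 <= v * (1 - v).
  by apply: mulr_ge0; [exact: up_prob_ge0|rewrite subr_ge0; exact: up_prob_le1].
rewrite (_ : _ + _ = v * (1 - v) * ((g1 - g0) * (f1 - f0))); last ring.
rewrite normrM ger0_norm// normrM [leRHS](_ : _ = v * (1 - v) * (`|g1 - g0| * (2 * c))); last ring.
apply: ler_wpM2l => //; apply: ler_wpM2l => //.
have := Df y; rewrite /D -/f1 -/f0 normrM normfV (@ger0_norm _ 2)//.
by rewrite ler_pdivrMr// mulrC.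
Qed.

Context (A : 'I_n -> 'I_n -> R) (alpha : R).
Hypothesis A_ge0 : forall i j, 0 <= A i j.
Hypothesis A_row : forall i, \sum_j A i j <= alpha.
Hypothesis A_col : forall j, \sum_i A i j <= alpha.
Hypothesis alpha_ge0 : 0 <= alpha.
Hypothesis alpha_lt1 : alpha < 1.
Hypothesis influence : forall i k x, i != k ->
  `|up_prob i (set_coord x k true) - up_prob i (set_coord x k false)| <= A i k.

Lemma D_CE_set1_eq0 i f x : D i (E [set i] f) x = 0.
Proof.
rewrite /D; have same b : E [set i] f (set_coord x i b) = E [set i] f x.
  by apply: CE_same; apply: same_off_set_coord; rewrite inE.
by rewrite !same subrr mul0r.
Qed.

(** Averaging over the spin [i] makes [f] depend on the spin [k] in a second
way, through the conditional law of the spin [i]; the influence bounds this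
new dependence. *)
Lemma D_CE_set1_le i k f x (ci ck : R) : i != k ->
  (forall z, `|D i f z| <= ci) -> (forall z, `|D k f z| <= ck) ->
  `|D k (E [set i] f) x| <= ck + A i k * ci.
Proof.
move=> ik Di Dk; rewrite /D !CE_set1.
set u := up_prob i _; set v := up_prob i (set_coord x k false).
have ki : k != i by rewrite eq_sym.
have := Dk (set_coord x i true); have := Dk (set_coord x i false).
have := Di (set_coord x k false); rewrite /D !(set_coordC _ _ _ ki).
set a := f (set_coord (set_coord x i true) k false).
set b := f (set_coord (set_coord x i false) k false).
set a' := f (set_coord (set_coord x i true) k true).
set b' := f (set_coord (set_coord x i false) k true) => Di0 Dk0 Dk1.
have inf := influence x ik; rewrite -/u -/v in inf.
have u0 : 0 <= u by exact: up_prob_ge0.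
have u1 : 0 <= 1 - u by rewrite subr_ge0 up_prob_le1.
rewrite (_ : (_ - _) / 2 = u * ((a' - a) / 2) + (1 - u) * ((b' - b) / 2) +
  (u - v) * ((a - b) / 2)); last by field.
apply: le_trans (ler_normD _ _) _; apply: lerD; last first.
  by rewrite normrM ler_pM.
apply: le_trans (ler_normD _ _) _.
rewrite [`|u * _|]normrM [`|(1 - u) * _|]normrM (ger0_norm u0) (ger0_norm u1).
have := ler_wpM2l u0 Dk1; have := ler_wpM2l u1 Dk0; lra.
Qed.


Definition norm2_on S c : R := Num.sqrt (\sum_(j in S) c j ^+ 2).

Lemma norm2_on_ge0 S c : 0 <= norm2_on S c.
Proof. exact: sqrtr_ge0. Qed.

Lemma sqr_norm2_on S c : norm2_on S c ^+ 2 = \sum_(j in S) c j ^+ 2.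
Proof. by rewrite sqr_sqrtr// sumr_ge0// => j _; exact: sqr_ge0. Qed.

Lemma norm2_onZ S (k : R) c : 0 <= k -> norm2_on S (fun j => k * c j) = k * norm2_on S c.
Proof.
move=> k0; rewrite /norm2_on -{2}(ger0_norm k0) -sqrtr_sqr -sqrtrM ?sqr_ge0//.
by congr Num.sqrt; rewrite mulr_sumr; apply: eq_bigr => j _; rewrite exprMn.
Qed.

Lemma le_norm2_on S c j : j \in S -> c j <= norm2_on S c.
Proof.
move=> jS; apply: le_trans (ler_norm _) _; rewrite -sqrtr_sqr.
rewrite ler_sqrt; last by rewrite sumr_ge0// => i _; exact: sqr_ge0.
by rewrite (bigD1 j)//= lerDl sumr_ge0// => i _; exact: sqr_ge0.
Qed.

(** Schur's test: a nonnegative matrix has Euclidean operator norm at most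
[alpha] when its row and column sums are. *)
Lemma norm2_on_influence_le S c :
  norm2_on S (fun k => \sum_(i in S) A i k * c i) <= alpha * norm2_on S c.
Proof.
rewrite -(@ler_pXn2r _ 2) ?nnegrE ?norm2_on_ge0 ?mulr_ge0 ?norm2_on_ge0//.
rewrite exprMn !sqr_norm2_on.
apply: (@le_trans _ _ (\sum_(k in S) alpha * \sum_(i in S) A i k * c i ^+ 2)).
  apply: ler_sum => k kS.
  have := @sum_cauchy_schwarz R _ (mem S) (fun i => A i k) (fun=> 1) c
    (fun i _ => A_ge0 i k).
  under eq_bigr do rewrite mul1r; move/le_trans; apply.
  under eq_bigr do rewrite expr1n mulr1.
  apply: ler_wpM2r; first by apply: sumr_ge0 => i _; rewrite mulr_ge0 ?sqr_ge0.
  apply: le_trans (A_col k); rewrite [leRHS](bigID (mem S))/= lerDl.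
  exact: sumr_ge0.
rewrite -mulr_sumr expr2 -mulrA; apply: ler_wpM2l => //.
rewrite exchange_big/= mulr_sumr; apply: ler_sum => i iS.
rewrite -mulr_suml; apply: ler_wpM2r; first exact: sqr_ge0.
apply: le_trans (A_row i); rewrite [leRHS](bigID (mem S))/= lerDl.
exact: sumr_ge0.
Qed.

(** One step of random-scan heat-bath dynamics on the block [S]. *)
Definition glauber S f x : R := #|S|%:R^-1 * \sum_(i in S) E [set i] f x.

Lemma glauber_lipschitz S f c : S != set0 ->
  (forall j, j \in S -> forall z, `|D j f z| <= c j) ->
  forall k, k \in S -> forall z, `|D k (glauber S f) z| <=
    (1 - #|S|%:R^-1) * c k + #|S|%:R^-1 * \sum_(i in S) A i k * c i.
Proof.
move=> S0 Df k kS z; set m : R := #|S|%:R.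
have m_gt0 : 0 < m by rewrite ltr0n card_gt0.
have -> : D k (glauber S f) z = m^-1 * \sum_(i in S) D k (E [set i] f) z.
  rewrite /D /glauber -mulrBr -sumrB -mulrA; congr (_ * _).
  by rewrite mulr_suml.
rewrite normrM ger0_norm ?invr_ge0 ?(ltW m_gt0)//.
rewrite (_ : _ + _ = m^-1 * (\sum_(i in S) (c k + A i k * c i) - c k)).
  rewrite ler_pM2l ?invr_gt0//; apply: le_trans (ler_norm_sum _ _ _) _.
  rewrite (bigD1 k)//= D_CE_set1_eq0 normr0 add0r.
  rewrite [X in _ <= X - _](bigD1 k)//= [leRHS](_ : _ =
    A k k * c k + \sum_(i in S | i != k) (c k + A i k * c i)); last ring.
  apply: ler_wpDl.
    by rewrite mulr_ge0// (le_trans _ (Df k kS z)).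
  apply: ler_sum => i /andP[iS ik]; apply: D_CE_set1_le => //; exact: Df.
rewrite big_split/= sumr_const -[c k *+ _]mulr_natl -/m.
by field; rewrite gt_eqF.
Qed.

(** One step of the dynamics contracts the vector of Lipschitz constants. *)
Lemma norm2_on_glauber_le S c : (0 < #|S|)%N ->
  norm2_on S (fun k => (1 - #|S|%:R^-1) * c k + #|S|%:R^-1 * \sum_(i in S) A i k * c i)
  <= (1 - (1 - alpha) / #|S|%:R) * norm2_on S c.
Proof.
move=> Sgt0; set m : R := #|S|%:R.
have m_gt0 : 0 < m by rewrite ltr0n.
have m1 : 0 <= 1 - m^-1 by rewrite subr_ge0 invf_le1// ler1n.
have mV : 0 <= m^-1 by rewrite invr_ge0 ltW.
apply: le_trans (sum_minkowski _ _ _) _.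
rewrite -/(norm2_on S (fun k => (1 - m^-1) * c k)).
rewrite -/(norm2_on S (fun k => m^-1 * \sum_(i in S) A i k * c i)) !norm2_onZ//.
have := ler_wpM2l mV (norm2_on_influence_le S c); lra.
Qed.

(** Change the coordinates of [S] one at a time. *)
Lemma lipschitz_same_off S f c x y :
  (forall j, j \in S -> forall z, `|D j f z| <= c j) -> same_off S x y ->
  `|f y - f x| <= 2 * \sum_(j in S) c j.
Proof.
move: {2}#|S| (erefl #|S|) => m; elim: m S x y => [|m IH] S x y Sm Df xy.
  have S0 : S = set0 by apply/eqP; rewrite -cards_eq0 Sm.
  move: xy; rewrite S0 same_off_set0 => /eqP ->.
  by rewrite subrr normr0 big_set0 mulr0.
have /card_gt0P[i iS] : (0 < #|S|)%N by rewrite Sm.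
pose y' := set_coord y i (x i).
have xy' : same_off (S :\ i) x y'.
  apply/same_offP => j; rewrite !inE negb_and negbK ffunE.
  by case: eqP => [->//|_ /= jS]; exact: (same_offP _ _ _ xy).
have SmD : #|S :\ i| = m by apply/eqP; rewrite -eqSS -Sm (cardsD1 i S) iS.
have le' := IH _ _ _ SmD (fun j jS => Df j (subsetP (subD1set S i) j jS)) xy'.
have le1 : `|f y - f y'| <= 2 * c i.
  have := Df i iS y; rewrite /D normrM normfV (@ger0_norm _ 2)// ler_pdivrMr//.
  rewrite [c i * 2]mulrC; apply: le_trans.
  rewrite -[y in f y](set_coord_id y i) /y'.
  by case: (y i); case: (x i); rewrite ?subrr ?normr0// distrC.
rewrite (big_setD1 i)//= mulrDr (_ : f y - f x = (f y - f y') + (f y' - f x)).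
  by apply: le_trans (ler_normD _ _) _; exact: lerD.
ring.
Qed.

Lemma le_of_geometric (a b X r : R) : 0 <= r < 1 ->
  (forall N, a <= b + r ^+ N * X) -> a <= b.
Proof.
move=> /andP[r0 r1] H.
have cv : ((fun N => b + r ^+ N * X) @ \oo --> b + 0 * X)%classic.
  apply: cvgD; first exact: cvg_cst.
  by apply: cvgMl; apply: cvg_expr; rewrite ger0_norm.
rewrite mul0r addr0 in cv; apply: (cvgr_to_ge cv).
exact: nearW.
Qed.

(** A comparison theorem of Dobrushin type for covariances. Splitting off one
step of the dynamics gives [cov g f] as an average of single-site terms, at
most [t * norm2_on S c / #|S|], plus the covariance of [g] with a function
whose Lipschitz constants are smaller by the factor
[r = 1 - (1 - alpha) / #|S|]; iterating sums a geometric series. The crude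
constant [B] bounds the covariance left over after [N] steps. *)
Lemma dobrushin_cov S g f c x :
  (forall j, j \in S -> forall z, `|D j f z| <= c j) ->
  `|cov p S g f x| <=
  (1 - alpha)^-1 * norm2_on S (fun j => E S (local_slope j g) x) * norm2_on S c.
Proof.
move=> Df; have [S0|S0] := eqVneq S set0.
  rewrite {1}S0 /cov !CE_set0// subrr normr0 !mulr_ge0 ?norm2_on_ge0//.
  by rewrite invr_ge0 subr_ge0 ltW.
have Sgt0 : (0 < #|S|)%N by rewrite card_gt0.
set t := norm2_on S (fun j => _); set m : R := #|S|%:R.
have m_gt0 : 0 < m by rewrite ltr0n.
pose r : R := 1 - (1 - alpha) / m.
have r01 : 0 <= r < 1.
  rewrite /r; apply/andP; split; last by rewrite ltrBlDr ltrDl divr_gt0 ?subr_gt0.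
  by rewrite subr_ge0 ler_pdivrMr// mul1r (@le_trans _ _ 1) ?ler1n// lerBlDr lerDl.
pose B := (E S (fun y => `|g y|) x + `|E S g x|) * (2 * m).
suff H N : forall f c, (forall j, j \in S -> forall z, `|D j f z| <= c j) ->
    `|cov p S g f x| <= ((1 - alpha)^-1 * t + r ^+ N * B) * norm2_on S c.
  apply: (@le_of_geometric _ _ (B * norm2_on S c) r r01) => N.
  by have := H N f c Df; rewrite mulrDl !mulrA.
elim: N => [|N IH] {}f {}c {}Df.
  apply: (@le_trans _ _ (B * norm2_on S c)); last first.
    rewrite expr0 mul1r ler_wpM2r ?norm2_on_ge0// lerDr mulr_ge0 ?norm2_on_ge0//.
    by rewrite invr_ge0 subr_ge0 ltW.
  have sum_le : \sum_(j in S) c j <= m * norm2_on S c.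
    apply: (@le_trans _ _ (\sum_(j in S) norm2_on S c)).
      by apply: ler_sum => j jS; exact: le_norm2_on.
    by rewrite sumr_const mulr_natl.
  have osc y : same_off S x y -> `|f y - f x| <= 2 * m * norm2_on S c.
    move=> /(lipschitz_same_off Df)/le_trans; apply.
    by rewrite -mulrA ler_pM2l.
  have -> : cov p S g f x = cov p S g (fun y => f y - f x) x.
    by rewrite (covDr S g f (fun=> - f x)) cov_cstr// addr0.
  rewrite /cov /B; apply: le_trans (ler_normB _ _) _.
  rewrite mulrDl mulrDl; apply: lerD.
    apply: le_trans (CE_abs p_gt0 _ _ _) _.
    rewrite -mulrA mulrC -CEZ; apply: le_CE => // y xy.
    by rewrite normrM mulrC ler_wpM2r// osc.
  rewrite normrM -mulrA ler_wpM2l//.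
  apply: le_trans (CE_abs p_gt0 _ _ _) _.
  rewrite -[leRHS](CE_cst p_gt0 S _ x); exact: le_CE.
have := IH _ _ (glauber_lipschitz S0 Df).
set c' := (X in norm2_on S X) => IHc'.
have c'_le : norm2_on S c' <= r * norm2_on S c by exact: norm2_on_glauber_le.
have [r_ge0 _] := andP r01.
have B_ge0 : 0 <= B.
  by rewrite !mulr_ge0// ?(ltW m_gt0)// addr_ge0// CE_ge0.
have split_cov : cov p S g f x =
    m^-1 * \sum_(j in S) cov p S g (fun y => f y - E [set j] f y) x +
    cov p S g (glauber S f) x.
  rewrite /glauber covZr cov_sumr -mulrDr -big_split/=.
  under eq_bigr do rewrite -covDr.
  rewrite (eq_bigr (fun=> cov p S g f x)) => [|j _]; last first.
    by apply: eq_cov => // y _; ring.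
  by rewrite sumr_const -[cov _ _ _ _ _ *+ _]mulr_natl -/m; field; rewrite gt_eqF.
have local_le : `|\sum_(j in S) cov p S g (fun y => f y - E [set j] f y) x|
    <= t * norm2_on S c.
  apply: le_trans (ler_norm_sum _ _ _) _.
  apply: le_trans (le_trans (ler_norm _) (sum_cauchy_schwarz_sqrt _ _ _)).
  by apply: ler_sum => j jS; apply: cov_local => //; exact: Df.
rewrite split_cov; apply: le_trans (ler_normD _ _) _.
rewrite normrM ger0_norm ?invr_ge0 ?(ltW m_gt0)//.
have al : 0 < 1 - alpha by rewrite subr_gt0.
have K_ge0 : 0 <= (1 - alpha)^-1 * t + r ^+ N * B.
  apply: addr_ge0; apply: mulr_ge0 => //; last exact: exprn_ge0.
    by rewrite invr_ge0 ltW.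
  exact: norm2_on_ge0.
have mV : 0 <= m^-1 by rewrite invr_ge0 ltW.
have := ler_wpM2l K_ge0 c'_le; have := ler_wpM2l mV local_le.
have -> : ((1 - alpha)^-1 * t + r ^+ N.+1 * B) * norm2_on S c =
  m^-1 * (t * norm2_on S c) + ((1 - alpha)^-1 * t + r ^+ N * B) * (r * norm2_on S c).
  by rewrite exprS /r; field; rewrite !gt_eqF.
move=> h1 h2; apply: lerD => //; exact: le_trans h2.
Qed.

Definition spin_at i x : R := if x i then 1 else -1.

Lemma D_spin_at i j x : D j (spin_at i) x = (i == j)%:R.
Proof.
rewrite /D /spin_at !ffunE; case: eqP => _ /=; last by rewrite subrr mul0r.
by field.
Qed.

(** Duality: the covariance bound is applied to the linear function of the spins
whose coefficients are the covariances [b i] themselves. *)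
Lemma sum_sqr_cov_spin_le S g x :
  \sum_(i in S) cov p S g (spin_at i) x ^+ 2 <=
  (1 - alpha) ^- 2 * \sum_(j in S) E S (local_slope j g) x ^+ 2.
Proof.
pose b i := cov p S g (spin_at i) x.
pose f y := \sum_(i in S) b i * spin_at i y.
have Df j : j \in S -> forall z, `|D j f z| <= `|b j|.
  move=> jS z; rewrite (_ : D j f z = b j)// /D /f -sumrB mulr_suml.
  under eq_bigr => i _ do rewrite -mulrBr -mulrA -/(D j (spin_at i) z) D_spin_at.
  rewrite (bigD1 j)//= eqxx mulr1 big1 ?addr0// => i /andP[_ /negPf ->].
  by rewrite mulr0.
have := dobrushin_cov g x Df; set t := norm2_on S (fun j => E _ _ _).
have -> : norm2_on S (fun j => `|b j|) = norm2_on S b.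
  by congr Num.sqrt; apply: eq_bigr => j _; rewrite real_normK ?num_real.
have -> : cov p S g f x = norm2_on S b ^+ 2.
  rewrite /f cov_sumr sqr_norm2_on; apply: eq_bigr => i _.
  by rewrite covZr expr2.
rewrite ger0_norm ?sqr_ge0// => le_b.
rewrite -!sqr_norm2_on -/b -/t -exprVn -exprMn.
have al : 0 < 1 - alpha by rewrite subr_gt0.
rewrite ler_pXn2r ?nnegrE ?norm2_on_ge0//; last by rewrite mulr_ge0 ?norm2_on_ge0// invr_ge0 ltW.
have := norm2_on_ge0 S b; rewrite le_eqVlt => /predU1P[<-|b0].
  by rewrite mulr_ge0 ?norm2_on_ge0// invr_ge0 ltW.
by move: le_b; rewrite expr2 ler_pM2r.
Qed.

End Dobrushin.

(** * Poincare and logarithmic Sobolev inequalities *)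

Definition flip {n} (x : config n) (i : 'I_n) : config n := set_coord x i (~~ x i).

(** One-sided, because the entropy of [expR f] is controlled by the decrements
of [f] alone: these can be weighted by the larger of two values of [expR f]. *)
Definition upper_grad_sqr {R : realType} {n} (f : config n -> R) (x : config n) : R :=
  \sum_i Num.max 0 (f x - f (flip x i)) ^+ 2.

Section Tensorization.
Context {R : realType} {n : nat} {p : config n -> R}.
Hypothesis p_gt0 : forall x, 0 < p x.
Implicit Types (S T : {set 'I_n}) (x y z : config n) (g h u f : config n -> R).
Implicit Types (i j k : 'I_n) (c : 'I_n -> R).

Local Notation E := (CE p).

(** Induction on the block: averaging over [i] in [S] the decomposition of
[F S] into the mean of [F (S :\ i)] and a remainder gives [#|S|] times [F S]
on the left, and the [#|S| - 1] occurrences of each single-site term leave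
room for exactly one more, supplied by the remainders. *)
Lemma tensorization (F : {set 'I_n} -> config n -> R) (G : 'I_n -> config n -> R)
    (C : R) : (forall x, F set0 x <= 0) ->
  (forall S x, \sum_(i in S) (F S x - E S (F (S :\ i)) x) <=
    C * \sum_(j in S) E S (G j) x) ->
  forall S x, F S x <= C * \sum_(j in S) E S (G j) x.
Proof.
move=> F0 deficit S; move: {2}#|S| (erefl #|S|) => m.
elim: m S => [|m IH] S Sm x.
  have -> : S = set0 by apply/eqP; rewrite -cards_eq0 Sm.
  by rewrite big_set0 mulr0.
set W := \sum_(j in S) E S (G j) x.
have le_sum : \sum_(i in S) E S (F (S :\ i)) x <= \sum_(i in S) C * (W - E S (G i) x).
  apply: ler_sum => i iS.
  have SmD : #|S :\ i| = m by apply/eqP; rewrite -eqSS -Sm (cardsD1 i S) iS.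
  apply: (le_trans (le_CE p_gt0 (fun y _ => IH (S :\ i) SmD y))).
  rewrite CEZ CE_sum /W [X in _ <= C * (X - _)](big_setD1 i)//=.
  rewrite addrAC subrr add0r le_eqVlt.
  apply/orP; left; apply/eqP; congr (_ * _); apply: eq_bigr => j _.
  by rewrite CE_tower// subD1set.
have := deficit S x; rewrite -/W sumrB sumr_const.
rewrite -mulr_sumr sumrB sumr_const -/W Sm in le_sum *.
rewrite -[F S x *+ _]mulr_natl; rewrite -[W *+ _]mulr_natl in le_sum.
move=> H; rewrite -(@ler_pM2l _ m.+1%:R) ?ltr0n//; lra.
Qed.

Context (A : 'I_n -> 'I_n -> R) (alpha : R).
Hypothesis A_ge0 : forall i j, 0 <= A i j.
Hypothesis A_row : forall i, \sum_j A i j <= alpha.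
Hypothesis A_col : forall j, \sum_i A i j <= alpha.
Hypothesis alpha_ge0 : 0 <= alpha.
Hypothesis alpha_lt1 : alpha < 1.
Hypothesis influence : forall i k x, i != k ->
  `|up_prob (p := p) i (set_coord x k true) - up_prob (p := p) i (set_coord x k false)| <= A i k.
Context (gamma : R).
Hypothesis gamma_gt0 : 0 < gamma.
Hypothesis var_spin : forall i x, gamma <= cov p [set i] (spin_at i) (spin_at i) x.

Lemma var_spin_ge S i x : i \in S -> gamma <= cov p S (spin_at i) (spin_at i) x.
Proof.
move=> iS; rewrite (cov_tower p_gt0 _ _ _ (_ : [set i] \subset S)) ?sub1set//.
rewrite -[gamma]addr0 lerD ?var_ge0// -[leLHS](CE_cst p_gt0 S _ x).
by apply: le_CE => // y _.
Qed.

(** Given the spins outside [S], [E (S :\ i) g] is an affine function of the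
spin [i], so its variance is the squared covariance with that spin divided
by the variance of the spin. *)
Lemma var_marginal_le S i g x : i \in S ->
  cov p S (E (S :\ i) g) (E (S :\ i) g) x <= gamma^-1 * cov p S g (spin_at i) x ^+ 2.
Proof.
move=> iS; set u := E _ g; set b := D i u x.
pose a := (u (set_coord x i true) + u (set_coord x i false)) / 2.
set s := spin_at i; set V := cov p S s s x.
have uE y : same_off S x y -> u y = a + b * s y.
  move=> xy; have -> : u y = u (set_coord x i (y i)).
    apply/esym/CE_same/same_offP => j; rewrite !inE negb_and negbK ffunE.
    case: eqP => [->//|_ /= jS]; exact/esym/(same_offP _ _ _ xy).
  by rewrite /s /spin_at; case: (y i); rewrite /a /b /D; field.
have cov_u h : cov p S h u x = b * cov p S h s x.
  rewrite (eq_cov (g' := h) (h' := fun y => a + b * s y))//.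
  by rewrite (covDr S h (fun=> a)) cov_cstr// covZr add0r.
have covE : cov p S g s x = b * V.
  have sE : E (S :\ i) s = s.
    apply/funext => y; rewrite -[RHS](CE_cst p_gt0 (S :\ i) _ y).
    apply: eq_CE => z /same_offP yz; rewrite /s /spin_at yz//.
    by rewrite !inE eqxx.
  rewrite -sE cov_CE ?subD1set// sE -/u covC cov_u; congr (_ * _).
have -> : cov p S u u x = b ^+ 2 * V by rewrite cov_u covC cov_u expr2 mulrA.
have gV : gamma <= V by exact: var_spin_ge.
have V0 : 0 <= V := le_trans (ltW gamma_gt0) gV.
rewrite covE ler_pdivlMl// [(b * V) ^+ 2]exprMn [gamma * _]mulrCA ler_wpM2l ?sqr_ge0//.
by rewrite expr2 ler_wpM2r.
Qed.

Lemma sum_var_marginal_le S g x :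
  \sum_(i in S) cov p S (E (S :\ i) g) (E (S :\ i) g) x <=
  (gamma * (1 - alpha) ^+ 2)^-1 *
    \sum_(j in S) E S (local_slope (p := p) j g) x ^+ 2.
Proof.
rewrite invfM -mulrA.
apply: le_trans (ler_wpM2l _ (sum_sqr_cov_spin_le p_gt0 A_ge0 A_row A_col
  alpha_ge0 alpha_lt1 influence S g x)); last by rewrite invr_ge0 ltW.
by rewrite mulr_sumr; apply: ler_sum => i; exact: var_marginal_le.
Qed.

Lemma local_slope_le i g x : local_slope (p := p) i g x <= `|D i g x|.
Proof.
rewrite /local_slope /D normrM normfV (@ger0_norm _ 2)//.
rewrite mulrC; apply: ler_wpM2l => //.
set v := up_prob i x; have := sqr_ge0 (v - 1 / 2); nra.
Qed.

Lemma poincare S g x :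
  cov p S g g x <= (gamma * (1 - alpha) ^+ 2)^-1 *
    \sum_(j in S) E S (fun y => D j g y ^+ 2) x.
Proof.
apply: (tensorization (F := fun S => cov p S g g) (G := fun j y => D j g y ^+ 2)).
  by move=> {}x; rewrite /cov !CE_set0// subrr.
move=> {}S {}x; have al : 0 < 1 - alpha by rewrite subr_gt0.
have C0 : 0 <= (gamma * (1 - alpha) ^+ 2)^-1.
  by rewrite invr_ge0 mulr_ge0 ?sqr_ge0// ltW.
rewrite (eq_bigr (fun i => cov p S (E (S :\ i) g) (E (S :\ i) g) x)); last first.
  by move=> i _; rewrite (cov_tower p_gt0 _ _ _ (subD1set S i)); ring.
apply: le_trans (sum_var_marginal_le S g x) _.
apply: ler_wpM2l => //; apply: ler_sum => j jS.
have := CE_cauchy_schwarz p_gt0 S (local_slope (p := p) j g) (fun=> 1) x.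
rewrite expr1n CE_cst// mulr1; under eq_CE do rewrite mulr1.
move/le_trans; apply; apply: le_CE => // y _.
rewrite -[leRHS]real_normK ?num_real// ler_pXn2r ?nnegrE//.
  exact: local_slope_le.
exact: local_slope_ge0.
Qed.

Definition ent S g x : R :=
  E S (fun y => g y * ln (g y)) x - E S g x * ln (E S g x).

(** From [ln y <= y - 1] at [y = u / E S u]. *)
Lemma ent_le_var S u x : (forall y, 0 < u y) ->
  ent S u x <= cov p S u u x / E S u x.
Proof.
move=> u0; have m0 : 0 < E S u x by exact: CE_gt0.
set m := E S u x in m0 *; rewrite /ent /cov -/m.
have le y : u y * ln (u y) <= ln m * u y + m^-1 * (u y * u y) - u y.
  have := @le_ln1Dx R (u y / m - 1); rewrite addrCA subrr addr0.
  have um : 0 < u y / m by rewrite divr_gt0.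
  rewrite ltrBrDr addrC subrr => /(_ um); rewrite lnM ?posrE ?invr_gt0// lnV ?posrE//.
  move=> /(ler_wpM2l (ltW (u0 y))); lra.
have := le_CE p_gt0 (fun y (_ : same_off S x y) => le y).
rewrite CEB CED !CEZ -/m => H.
have -> : (E S (fun y => u y * u y) x - m * m) / m = m^-1 * E S (fun y => u y * u y) x - m.
  by field; rewrite gt_eqF.
lra.
Qed.

(** The difference of the two exponentials is at most the larger one times the
difference of the exponents; keeping only the weight of the larger value
turns the product of both probabilities into a conditional mean. *)
Lemma local_slope_expR_le i f x :
  local_slope (p := p) i (fun y => expR (f y)) x <=
  2 * E [set i] (fun y => Num.max 0 (f y - f (flip y i)) * expR (f y)) x.
Proof.
rewrite CE_set1// /flip !set_coordE eqxx [~~ true]/= [~~ false]/= !set_coord2 /local_slope.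
have v0 := up_prob_ge0 p_gt0 i x; have v1 := up_prob_le1 p_gt0 i x.
move: (up_prob i x) v0 v1 => v v0 v1.
move: (f (set_coord x i true)) (f (set_coord x i false)) => a b.
have key (c d : R) : c <= d -> 0 <= expR d - expR c <= (d - c) * expR d.
  move=> cd; have := expR_ge1Dx (c - d); rewrite expRD expRN.
  have d0 := expR_gt0 d; rewrite ler_pdivlMr// => H.
  by rewrite subr_ge0 ler_expR cd /=; lra.
have vv : 0 <= v * (1 - v) by rewrite mulr_ge0// subr_ge0.
have [ab|/ltW ba] := leP a b.
  have /andP[k0 k1] := key _ _ ab.
  rewrite distrC ger0_norm// max_l ?subr_le0// max_r ?subr_ge0// mul0r mulr0 add0r.
  rewrite -mulrA ler_pM2l//; apply: le_trans (ler_wpM2l vv k1) _.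
  by apply: ler_wpM2r; [rewrite mulr_ge0 ?subr_ge0 ?expR_ge0|nra].
have /andP[k0 k1] := key _ _ ba.
rewrite ger0_norm// max_r ?subr_ge0// max_l ?subr_le0// mul0r mulr0 addr0.
rewrite -mulrA ler_pM2l//; apply: le_trans (ler_wpM2l vv k1) _.
by apply: ler_wpM2r; [rewrite mulr_ge0 ?subr_ge0 ?expR_ge0|nra].
Qed.

Lemma sqr_CE_local_slope_le S i f x : i \in S ->
  E S (local_slope (p := p) i (fun y => expR (f y))) x ^+ 2 <=
  4 * E S (fun y => expR (f y)) x *
    E S (fun y => Num.max 0 (f y - f (flip y i)) ^+ 2 * expR (f y)) x.
Proof.
move=> iS; pose h y := Num.max 0 (f y - f (flip y i)) * expR (f y).
have le1 : E S (local_slope (p := p) i (fun y => expR (f y))) x <= 2 * E S h x.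
  rewrite -(CE_tower p_gt0 h x (_ : [set i] \subset S)) ?sub1set// -CEZ.
  by apply: le_CE => // y _; exact: local_slope_expR_le.
have sl0 : 0 <= E S (local_slope (p := p) i (fun y => expR (f y))) x.
  by apply: CE_ge0 => // y; exact: local_slope_ge0.
apply: (@le_trans _ _ ((2 * E S h x) ^+ 2)).
  by rewrite ler_pXn2r ?nnegrE// (le_trans sl0).
have := CE_cauchy_schwarz p_gt0 S
  (fun y => Num.max 0 (f y - f (flip y i)) * expR (f y / 2)) (fun y => expR (f y / 2)) x.
have e2 y : expR (f y / 2) * expR (f y / 2) = expR (f y).
  by rewrite -expRD; congr expR; field.
have -> : E S (fun y => Num.max 0 (f y - f (flip y i)) * expR (f y / 2) *
    expR (f y / 2)) x = E S h x by apply: eq_CE => y _; rewrite -mulrA e2.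
have -> : E S (fun y => (Num.max 0 (f y - f (flip y i)) * expR (f y / 2)) ^+ 2) x =
    E S (fun y => Num.max 0 (f y - f (flip y i)) ^+ 2 * expR (f y)) x.
  by apply: eq_CE => y _; rewrite exprMn [expR _ ^+ 2]expr2 e2.
have -> : E S (fun y => expR (f y / 2) ^+ 2) x = E S (fun y => expR (f y)) x.
  by apply: eq_CE => y _; rewrite expr2 e2.
lra.
Qed.

(** The remainder of the entropy at one spin is at most the variance of a
marginal divided by the mean; the covariance bound reduces this variance to
the local slopes of [expR f], and Cauchy-Schwarz releases a factor
[E S (expR f)] that cancels the division. *)
Lemma log_sobolev S f x :
  ent S (fun y => expR (f y)) x <= 4 * (gamma * (1 - alpha) ^+ 2)^-1 *
    \sum_(j in S) E S (fun y => Num.max 0 (f y - f (flip y j)) ^+ 2 * expR (f y)) x.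
Proof.
pose g y := expR (f y); pose G j y := Num.max 0 (f y - f (flip y j)) ^+ 2 * expR (f y).
have g0 y : 0 < g y by exact: expR_gt0.
apply: (tensorization (F := fun S => ent S g) (G := G)).
  by move=> {}x; rewrite /ent !CE_set0// subrr.
move=> {}S {}x; have al : 0 < 1 - alpha by rewrite subr_gt0.
set C := (gamma * (1 - alpha) ^+ 2)^-1.
have C0 : 0 <= C by rewrite invr_ge0 mulr_ge0 ?sqr_ge0// ltW.
have m0 : 0 < E S g x by exact: CE_gt0.
have le1 : \sum_(i in S) (ent S g x - E S (ent (S :\ i) g) x) <=
    \sum_(i in S) cov p S (E (S :\ i) g) (E (S :\ i) g) x / E S g x.
  apply: ler_sum => i iS; have sub := subD1set S i.
  have u0 y : 0 < E (S :\ i) g y by exact: CE_gt0.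
  have := @ent_le_var S (E (S :\ i) g) x u0.
  rewrite CE_tower//; apply: le_trans.
  by rewrite /ent CEB !CE_tower//; lra.
apply: (le_trans le1); rewrite -mulr_suml ler_pdivrMr//.
apply: le_trans (sum_var_marginal_le S g x) _.
rewrite -/C [4 * C]mulrC -!mulrA ler_wpM2l//.
rewrite mulr_suml mulr_sumr; apply: ler_sum => j jS.
by apply: le_trans (sqr_CE_local_slope_le f x jS) _; rewrite /G; lra.
Qed.

End Tensorization.

(** * The Ising model *)

(** The derivative of the logistic function is [e / (1 + e) ^+ 2] with
[e = expR (- c)], at most [1 / 4]. *)
Lemma logistic_lipschitz (R : realType) (u v : R) :
  `|(1 + expR (- u))^-1 - (1 + expR (- v))^-1| <= `|u - v| / 4.
Proof.
wlog uv : u v / v <= u.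
  have [vu|/ltW uv] := leP v u; first exact.
  by rewrite distrC [`|u - v|]distrC; exact.
pose s (t : R) := (1 + expR (- t))^-1.
pose ds (t : R) := expR (- t) / (1 + expR (- t)) ^+ 2.
have dsP (t : R) : is_derive t 1 s (ds t).
  have den : 1 + expR (- t) != 0 by rewrite gt_eqF// addr_gt0// expR_gt0.
  have dexp : is_derive t 1 (@expR R \o -%R) (expR (- t) * -1).
    by apply: is_derive1_comp.
  have dden : is_derive t 1 (cst 1 + (@expR R \o -%R)) (- expR (- t)).
    by apply: is_derive_eq; rewrite add0r mulrN1.
  have := @is_deriveV R (cst 1 + (@expR R \o -%R)) t (- expR (- t)) 1 den dden.
  by move/is_derive_eq; apply; rewrite /ds /GRing.scale /= mulrNN mulrC.
have [|c _ sE] := MVT_segment uv (fun t _ => dsP t).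
  apply: derivable_within_continuous => t _.
  by have [] := dsP t.
rewrite -/(s u) -/(s v) sE normrM mulrC ler_wpM2l//.
have e0 := expR_gt0 (- c).
rewrite /ds ger0_norm; last by rewrite divr_ge0 ?sqr_ge0 ?ltW.
rewrite ler_pdivrMr ?exprn_gt0 ?addr_gt0//.
have := sqr_ge0 (1 - expR (- c)); lra.
Qed.

Section SingleSite.
Context {R : realType} {n : nat} {p : config n -> R}.
Hypothesis p_gt0 : forall x, 0 < p x.

Lemma up_prob_eq (i : 'I_n) x :
  up_prob (p := p) i x = (1 + p (set_coord x i false) / p (set_coord x i true))^-1.
Proof.
have sumE (F : config n -> R) : \sum_(y | same_off [set i] x y) F y =
    F (set_coord x i true) + F (set_coord x i false).
  have same b : same_off [set i] x (set_coord x i b).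
    by apply: same_off_set_coord; rewrite inE.
  have neq : set_coord x i false != set_coord x i true.
    by apply/eqP => /ffunP/(_ i); rewrite !ffunE eqxx.
  rewrite (bigD1 (set_coord x i true))//= (bigD1 (set_coord x i false)) ?same//=.
  rewrite big1 ?addr0// => y /andP[/andP[/same_off1 -> ]].
  by case: (y i); rewrite eqxx.
rewrite /up_prob /CE /cond_expect /prob !sumE !set_coordE eqxx mulr1 mulr0 addr0.
have pt := p_gt0 (set_coord x i true); have pf := p_gt0 (set_coord x i false).
by field; rewrite !gt_eqF ?addr_gt0.
Qed.

End SingleSite.

Section IsingModel.
Context {R : realType} {n : nat} (J : 'M[R]_n) (h : 'cV[R]_n).
Hypothesis J_sym : J^T = J.
Hypothesis J_diag : forall i, J i i = 0.
Implicit Types (i j k : 'I_n) (x : config n).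

Local Notation P := (ising J h).

Lemma partition_gt0 : 0 < \sum_y ising_weight J h y.
Proof.
rewrite (bigD1 [ffun=> true])//= ltr_pwDl ?expR_gt0//.
by apply: sumr_ge0 => y _; exact: expR_ge0.
Qed.

Lemma ising_gt0 x : 0 < P x.
Proof. by rewrite divr_gt0 ?expR_gt0 ?partition_gt0. Qed.

Lemma ising_sum1 : \sum_x P x = 1.
Proof. by rewrite -mulr_suml divff// gt_eqF ?partition_gt0. Qed.

Definition local_field i x : R := (J *m spin x) i 0 + h i 0.

Lemma spin_set_coord i x :
  spin (set_coord x i true) = spin (set_coord x i false) + 2 *: delta_mx i 0 :> 'cV[R]_n.
Proof.
apply/matrixP => j k; rewrite !mxE !set_coordE (ord1 k) eqxx andbT.
by case: eqP => _ /=; ring.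
Qed.

Lemma local_field_set_coord i k x :
  local_field i (set_coord x k true) = local_field i (set_coord x k false) + 2 * J i k.
Proof.
rewrite /local_field spin_set_coord mulmxDr -scalemxAr -colE !mxE; ring.
Qed.

(** Flipping the spin [i] adds [2 *: delta_mx i 0] to the spin vector; the term
quadratic in this change vanishes since the diagonal of [J] is zero. *)
Lemma ising_weight_ratio i x :
  ising_weight J h (set_coord x i false) / ising_weight J h (set_coord x i true) =
  expR (- (2 * local_field i x)).
Proof.
rewrite /ising_weight -expRN -expRD; congr expR.
have lf : local_field i x = local_field i (set_coord x i false).
  have := local_field_set_coord i i x; rewrite J_diag mulr0 addr0 => E.
  by case xi : (x i); rewrite -[in LHS](set_coord_id x i) xi.
rewrite lf /local_field spin_set_coord.
set s := spin _; set e := delta_mx i 0.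
have eJe : (e^T *m J *m e) 0 0 = 0.
  by rewrite /e trmx_delta -rowE -colE !mxE.
have eJs : (e^T *m J *m s) 0 0 = (J *m s) i 0.
  by rewrite -mulmxA /e trmx_delta -rowE mxE.
have sJe : (s^T *m J *m e) 0 0 = (J *m s) i 0.
  transitivity ((s^T *m J *m e)^T 0 0); first by rewrite [RHS]mxE.
  by rewrite -eJs !trmx_mul trmxK J_sym mulmxA.
have he : (h^T *m e) 0 0 = h i 0 by rewrite /e -colE !mxE.
have -> : ((s + 2 *: e)^T *m J *m (s + 2 *: e)) 0 0 =
    (s^T *m J *m s) 0 0 + 4 * (J *m s) i 0.
  have -> : (s + 2 *: e)^T = s^T + 2 *: e^T by rewrite !linearE.
  rewrite mulmxDr !mulmxDl -!scalemxAl -!scalemxAr.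
  have addE (M N : 'M[R]_1) : (M + N) 0 0 = M 0 0 + N 0 0 by rewrite mxE.
  have scaleE (k : R) (M : 'M[R]_1) : (k *: M) 0 0 = k * M 0 0 by rewrite mxE.
  by rewrite !(addE, scaleE) eJe eJs sJe; ring.
have -> : (h^T *m (s + 2 *: e)) 0 0 = (h^T *m s) 0 0 + 2 * h i 0.
  by rewrite mulmxDr -scalemxAr mxE [X in _ + X]mxE he.
by field.
Qed.

Lemma ising_up_prob i x : up_prob (p := P) i x = (1 + expR (- (2 * local_field i x)))^-1.
Proof.
rewrite up_prob_eq; last exact: ising_gt0.
rewrite -ising_weight_ratio /ising; congr (1 + _)^-1.
have := partition_gt0; set Z := \sum_y _ => Z0.
by field; rewrite !gt_eqF ?expR_gt0.
Qed.

(** Flipping the spin [k] moves the local field at [i] by [2 * J i k], hence the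
argument of the logistic function by [4 * J i k], and the factor [1 / 4] of
the logistic function makes the influence exactly [`|J i k|]. *)
Lemma ising_influence i k x :
  `|up_prob (p := P) i (set_coord x k true) - up_prob (p := P) i (set_coord x k false)| <= `|J i k|.
Proof.
rewrite !ising_up_prob; apply: le_trans (logistic_lipschitz _ _) _.
rewrite local_field_set_coord ler_pdivrMr//.
rewrite (_ : _ - _ = J i k * 4); last ring.
by rewrite normrM (@ger0_norm _ 4).
Qed.

Lemma ising_cond_varE i x :
  ising_cond_var J h i x = cov P [set i] (spin_at i) (spin_at i) x.
Proof.
have ag : agree_off i x =1 same_off [set i] x.
  by move=> y; apply: eq_forallb => j; rewrite inE.
have condE g : cond_expect P (agree_off i x) g = CE P [set i] g x.
  by rewrite /CE /cond_expect /prob !(eq_bigl _ _ ag).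
rewrite /ising_cond_var /cond_var !condE.
have sE : CE P [set i] (fun y => spin y i 0) x = CE P [set i] (spin_at i) x.
  by apply: eq_CE => y _; rewrite mxE.
rewrite sE; set m := CE P [set i] (spin_at i) x; have P0 := ising_gt0.
rewrite (eq_CE (h := fun y => (spin_at i y * spin_at i y - 2 * m * spin_at i y) + m * m)).
  by rewrite CED CEB CEZ CE_cst// -/m /cov -/m; ring.
by move=> y _; rewrite mxE -/(spin_at i y); ring.
Qed.

Lemma inf_norm_ge0 : 0 <= inf_norm J.
Proof. exact: bigmax_ge_id. Qed.

Lemma row_sum_le i : \sum_j `|J i j| <= inf_norm J.
Proof. exact: (le_bigmax _ (fun i => \sum_j `|J i j|)). Qed.

Lemma col_sum_le j : \sum_i `|J i j| <= inf_norm J.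
Proof.
have symE i : `|J i j| = `|J j i| by rewrite -[in LHS]J_sym mxE.
by under eq_bigr do rewrite symE; exact: row_sum_le.
Qed.

Context (gamma : R).
Hypothesis gamma_gt0 : 0 < gamma.
Hypothesis alpha_lt1 : inf_norm J < 1.
Hypothesis gamma_le : forall i x, gamma <= ising_cond_var J h i x.

Let C := (gamma * (1 - inf_norm J) ^+ 2)^-1.

Lemma ising_poincare (g : config n -> R) :
  expect P (fun x => g x ^+ 2) - expect P g ^+ 2 <=
  C * \sum_j expect P (fun x => D j g x ^+ 2).
Proof.
have P0 := ising_gt0; have P1 := ising_sum1.
have := @poincare R n P P0 (fun i j => `|J i j|) (inf_norm J)
  (fun i j => normr_ge0 _) row_sum_le col_sum_le inf_norm_ge0 alpha_lt1
  (fun i k x _ => ising_influence i k x) gamma gamma_gt0.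
have vs i x : gamma <= cov P [set i] (spin_at i) (spin_at i) x.
  by rewrite -ising_cond_varE.
move=> /(_ vs setT g [ffun=> true]); rewrite /cov !CE_setT//.
under [X in _ <= _ * X -> _]eq_bigr do rewrite CE_setT//.
by under [X in _ <= _ * X -> _]eq_bigl do rewrite inE; rewrite expr2.
Qed.

Lemma ising_log_sobolev (f : config n -> R) :
  expect P (fun x => f x * expR (f x)) -
    expect P (fun x => expR (f x)) * ln (expect P (fun x => expR (f x))) <=
  4 * C * expect P (fun x => upper_grad_sqr f x * expR (f x)).
Proof.
have P0 := ising_gt0; have P1 := ising_sum1.
have := @log_sobolev R n P P0 (fun i j => `|J i j|) (inf_norm J)
  (fun i j => normr_ge0 _) row_sum_le col_sum_le inf_norm_ge0 alpha_lt1
  (fun i k x _ => ising_influence i k x) gamma gamma_gt0.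
have vs i x : gamma <= cov P [set i] (spin_at i) (spin_at i) x.
  by rewrite -ising_cond_varE.
move=> /(_ vs setT f [ffun=> true]); rewrite /ent -CE_sum !CE_setT//.
congr (_ - _ <= _ * _).
  by apply: eq_bigr => x _; rewrite expRK [expR _ * _]mulrC.
apply: eq_bigr => x _; rewrite /upper_grad_sqr mulr_suml; congr (_ * _).
by apply: eq_bigl => j; rewrite inE.
Qed.

End IsingModel.

(** * Second-order concentration *)

Section SpectralNorm.
Context {R : realType}.

Lemma norm2_ge0 n (v : 'cV[R]_n) : 0 <= norm2 v.
Proof. exact: sqrtr_ge0. Qed.

Lemma sqr_norm2 n (v : 'cV[R]_n) : norm2 v ^+ 2 = \sum_i v i 0 ^+ 2.
Proof. by rewrite sqr_sqrtr// sumr_ge0// => i _; exact: sqr_ge0. Qed.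

Lemma norm2Z n (k : R) (v : 'cV[R]_n) : norm2 (k *: v) = `|k| * norm2 v.
Proof.
rewrite /norm2 -sqrtr_sqr -sqrtrM ?sqr_ge0//; congr Num.sqrt.
by rewrite mulr_sumr; apply: eq_bigr => i _; rewrite mxE exprMn.
Qed.

(** Makes the set defining the spectral norm bounded, so that its supremum is
an upper bound. *)
Lemma norm2_mulmx_le_frobenius m n (A : 'M[R]_(m, n)) (v : 'cV[R]_n) :
  norm2 (A *m v) <= frobenius_norm A * norm2 v.
Proof.
rewrite /frobenius_norm /norm2 -sqrtrM; last first.
  by apply: sumr_ge0 => i _; apply: sumr_ge0 => j _; exact: sqr_ge0.
apply: ler_wsqrtr; rewrite mulr_suml; apply: ler_sum => i _; rewrite mxE.
have := @sum_cauchy_schwarz R _ xpredT (fun=> 1) (A i) (fun j => v j 0)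
  (fun _ _ => ler01).
rewrite (eq_bigr (fun j => A i j * v j 0)) => [|j _]; last by rewrite mul1r.
rewrite [X in _ <= X * _](eq_bigr (fun j => A i j ^+ 2)) => [|j _]; last by rewrite mul1r.
by rewrite [X in _ <= _ * X](eq_bigr (fun j => v j 0 ^+ 2)) => [//|j _]; rewrite mul1r.
Qed.

Lemma norm2_mulmx_le m n (A : 'M[R]_(m, n)) (v : 'cV[R]_n) :
  norm2 (A *m v) <= spectral_norm A * norm2 v.
Proof.
have [v0|v0] := eqVneq (norm2 v) 0.
  by have := norm2_mulmx_le_frobenius A v; rewrite v0 !mulr0.
have v_gt0 : 0 < norm2 v by rewrite lt_neqAle eq_sym v0 norm2_ge0.
rewrite -ler_pdivrMr//; apply: ub_le_sup.
  exists (frobenius_norm A) => _ [w /= w1 <-].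
  apply: le_trans (norm2_mulmx_le_frobenius _ _) _.
  by rewrite -[leRHS]mulr1 ler_wpM2l// sqrtr_ge0.
exists ((norm2 v)^-1 *: v) => /=.
  by rewrite norm2Z ger0_norm ?invr_ge0 ?norm2_ge0// mulVf.
by rewrite -scalemxAr norm2Z ger0_norm ?invr_ge0 ?norm2_ge0// mulrC.
Qed.

End SpectralNorm.

Lemma le_expect (R : realType) (T : finType) (p g h : T -> R) :
  (forall x, 0 <= p x) -> (forall x, g x <= h x) -> expect p g <= expect p h.
Proof. by move=> p0 gh; apply: ler_sum => x _; exact: ler_wpM2l. Qed.

Lemma expectZ (R : realType) (T : finType) (p g : T -> R) (k : R) :
  expect p (fun x => k * g x) = k * expect p g.
Proof. by rewrite /expect mulr_sumr; apply: eq_bigr => x _; ring. Qed.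

(** The entropy of [expR g] dominates its pairing with any [V] normalized by
[ln (E (expR V)) = 0] (the Gibbs variational principle); pointwise it is
[1 + u <= expR u]. *)
Lemma expect_expR_le_entropy (R : realType) (T : finType) (p g V : T -> R) :
  (forall x, 0 <= p x) -> \sum_x p x = 1 ->
  expect p (fun x => V x * expR (g x)) <=
  expect p (fun x => g x * expR (g x)) -
    expect p (fun x => expR (g x)) * ln (expect p (fun x => expR (g x))) +
  expect p (fun x => expR (g x)) * ln (expect p (fun x => expR (V x))).
Proof.
move=> p0 p1.
have pos (u : T -> R) : 0 < expect p (fun x => expR (u x)).
  have := @laplace_gt0 R T p u p0 p1 1; rewrite /laplace /expect.
  by under eq_bigr do rewrite mul1r.
have := pos g; have := pos V.
set Z := expect p (fun x => expR (g x)); set A := expect p (fun x => expR (V x)).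
move=> A_gt0 Z_gt0.
have pt x : V x * expR (g x) <= g x * expR (g x) - ln Z * expR (g x)
    + ln A * expR (g x) + (Z / A * expR (V x) - expR (g x)).
  have := expR_ge1Dx (V x - g x + ln Z - ln A).
  rewrite !expRD !expRN !lnK ?posrE//.
  move=> /(ler_wpM2r (expR_ge0 (g x))).
  have -> : expR (V x) / expR (g x) * Z / A * expR (g x) = Z / A * expR (V x).
    by field; rewrite !gt_eqF ?expR_gt0.
  lra.
have := le_expect p0 pt.
have -> : expect p (fun x => g x * expR (g x) - ln Z * expR (g x)
    + ln A * expR (g x) + (Z / A * expR (V x) - expR (g x))) =
    expect p (fun x => g x * expR (g x)) - ln Z * Z + ln A * Z + (Z / A * A - Z).
  rewrite /Z /A /expect !mulr_sumr -!sumrN -!big_split/=.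
  by apply: eq_bigr => x _; ring.
rewrite divfK ?gt_eqF//; lra.
Qed.

Section SecondOrder.
Context {R : realType} {n : nat} (p : config n -> R).
Hypothesis p_ge0 : forall x, 0 <= p x.
Hypothesis p_sum1 : \sum_x p x = 1.
Context (C : R).
Hypothesis C_gt0 : 0 < C.
Hypothesis log_sobolev : forall f : config n -> R,
  expect p (fun x => f x * expR (f x)) -
    expect p (fun x => expR (f x)) * ln (expect p (fun x => expR (f x))) <=
  C * expect p (fun x => upper_grad_sqr f x * expR (f x)).

Definition grad_sqr (f : config n -> R) x : R := \sum_j D j f x ^+ 2.

Lemma grad_sqr_ge0 f x : 0 <= grad_sqr f x.
Proof. by apply: sumr_ge0 => j _; exact: sqr_ge0. Qed.

Lemma sub_flip (g : config n -> R) x i :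
  g x - g (flip x i) = 2 * spin_at i x * D i g x.
Proof.
rewrite -[x in g x](set_coord_id x i) /flip /spin_at /D.
by case: (x i) => /=; field.
Qed.

Lemma sqr_spin_at i (x : config n) : spin_at i x ^+ 2 = 1 :> R.
Proof. by rewrite /spin_at; case: (x i); ring. Qed.

Lemma sqr_max0_le (a b : R) : a <= b -> Num.max 0 a ^+ 2 <= b ^+ 2.
Proof.
move=> ab; have [a0|/ltW a0] := leP a 0; first by rewrite expr0n sqr_ge0.
by rewrite ler_pXn2r ?nnegrE// (le_trans a0).
Qed.

Lemma upper_grad_sqrZ (s : R) (g : config n -> R) x : 0 <= s ->
  upper_grad_sqr (fun y => s * g y) x = s ^+ 2 * upper_grad_sqr g x.
Proof.
move=> s0; rewrite /upper_grad_sqr mulr_sumr; apply: eq_bigr => i _.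
by rewrite -exprMn -mulrBr maxr_pMr// mulr0.
Qed.

Lemma upper_grad_sqr_le f x : upper_grad_sqr f x <= 4 * grad_sqr f x.
Proof.
rewrite /grad_sqr mulr_sumr; apply: ler_sum => i _.
apply: le_trans (sqr_max0_le (lexx _)) _; rewrite sub_flip !exprMn sqr_spin_at.
by rewrite le_eqVlt; apply/orP; left; apply/eqP; ring.
Qed.

(** By [a ^+ 2 - b ^+ 2 <= 2 * a * (a - b)], the decrement of the squared gradient
at a flip is linear in the Hessian applied to the gradient at the current
point. This is what brings in the spectral norm rather than the Frobenius
norm, and why the one-sided gradient is needed. *)
Lemma upper_grad_sqr_grad_sqr_le f x :
  upper_grad_sqr (grad_sqr f) x <=
  16 * \sum_i (\sum_j D i (D j f) x * D j f x) ^+ 2.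
Proof.
rewrite mulr_sumr; apply: ler_sum => i _.
set Hg := \sum_j _.
have le : grad_sqr f x - grad_sqr f (flip x i) <= 4 * spin_at i x * Hg.
  rewrite /grad_sqr /Hg -sumrB mulr_sumr; apply: ler_sum => j _.
  have := sub_flip (D j f) x i.
  have := sqr_ge0 (D j f x - D j f (flip x i)).
  move: (D j f x) (D j f (flip x i)) (D i (D j f) x) (spin_at i x : R) => a b d s.
  move=> h e; have -> : 4 * s * (d * a) = 2 * a * (2 * s * d) by ring.
  by rewrite -e; lra.
apply: le_trans (sqr_max0_le le) _; rewrite !exprMn sqr_spin_at.
by rewrite le_eqVlt; apply/orP; left; apply/eqP; ring.
Qed.

Section Tail.
Context (f : config n -> R) (L : R).
Hypothesis L_ge0 : 0 <= L.
Hypothesis hessian_le : forall x,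
  \sum_i (\sum_j D i (D j f) x * D j f x) ^+ 2 <= L ^+ 2 * grad_sqr f x.

Local Notation M := (expect p (grad_sqr f)).

Lemma mean_grad_sqr_ge0 : 0 <= M.
Proof. by apply: sumr_ge0 => x _; rewrite mulr_ge0 ?grad_sqr_ge0. Qed.

(** The entropy of [expR (s * grad_sqr f)] is bounded by its own energy with
density [16 * L ^+ 2 * grad_sqr f], which is the case [b > 0] of Herbst's
argument; the constant [32] makes [1 - b * s >= 1 / 2]. *)
Lemma ln_laplace_grad_sqr_le (s : R) : 0 < s -> 32 * C * L ^+ 2 * s <= 1 ->
  ln (laplace p (grad_sqr f) s) <= 2 * s * M.
Proof.
move=> s_gt0 s_le.
pose b := 16 * C * L ^+ 2.
have b_ge0 : 0 <= b by rewrite !mulr_ge0 ?sqr_ge0// ltW.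
have step r : 0 < r <= s -> r * laplace_deriv p (grad_sqr f) r -
    laplace p (grad_sqr f) r * ln (laplace p (grad_sqr f) r) <=
    r ^+ 2 * (b * laplace_deriv p (grad_sqr f) r + 0 * laplace p (grad_sqr f) r).
  move=> /andP[/ltW r_ge0 _]; have := log_sobolev (fun x => r * grad_sqr f x).
  rewrite -/(laplace _ _ _).
  have -> : expect p (fun x => r * grad_sqr f x * expR (r * grad_sqr f x)) =
      r * laplace_deriv p (grad_sqr f) r.
    by rewrite -expectZ; apply: eq_bigr => x _; rewrite !mulrA.
  move/le_trans; apply.
  rewrite mul0r addr0 /laplace_deriv /b -!expectZ.
  apply: le_expect => // x; rewrite upper_grad_sqrZ//.
  have := le_trans (upper_grad_sqr_grad_sqr_le f x)
    (ler_wpM2l _ (hessian_le x)) => /(_ (ler0n _ 16)).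
  move/(ler_wpM2r (expR_ge0 (r * grad_sqr f x)))/(ler_wpM2l (sqr_ge0 r)).
  move/(ler_wpM2l (ltW C_gt0)); lra.
have := herbst_argument p_ge0 p_sum1 b_ge0 (lexx 0) step.
move=> /(_ s); rewrite s_gt0 lexx => /(_ isT).
have := mulr_ge0 (ltW s_gt0) mean_grad_sqr_ge0.
rewrite mul0r addr0; set l := ln _; set m := s * _ => m0 H.
have bs : b * s <= 1 / 2 by rewrite /b; lra.
rewrite -mulrA -/m; have [l0|l0] := leP l 0; nra.
Qed.

(** The energy of [expR (r * f)] is at most its pairing with [4 * r ^+ 2 * grad_sqr f].
With [V = 8 * C * r ^+ 2 * grad_sqr f] the variational principle moves this
pairing into half of the entropy plus a Laplace transform of the squared
gradient, and the former is absorbed. *)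
Lemma ln_laplace_le_second_order (s : R) : 0 < s -> 16 * C * L * s <= 1 ->
  ln (laplace p f s) <= s * expect p f + 16 * C * M * s ^+ 2.
Proof.
move=> s_gt0 s_le.
have step r : 0 < r <= s -> r * laplace_deriv p f r -
    laplace p f r * ln (laplace p f r) <=
    r ^+ 2 * (0 * laplace_deriv p f r + 16 * C * M * laplace p f r).
  move=> /andP[r_gt0 r_le]; have r_ge0 := ltW r_gt0.
  pose t := 8 * C * r ^+ 2.
  have t_gt0 : 0 < t by rewrite !mulr_gt0// exprn_gt0.
  have t_le : 32 * C * L ^+ 2 * t <= 1.
    have -> : 32 * C * L ^+ 2 * t = (16 * C * L * r) ^+ 2 by rewrite /t; ring.
    rewrite expr_le1// ?mulr_ge0 ?(ltW C_gt0)//.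
    by apply: le_trans s_le; apply: ler_wpM2l => //; rewrite !mulr_ge0 ?(ltW C_gt0).
  have lnW := ln_laplace_grad_sqr_le t_gt0 t_le.
  have := expect_expR_le_entropy (fun x => r * f x) (fun x => t * grad_sqr f x)
    p_ge0 p_sum1.
  have := log_sobolev (fun x => r * f x).
  rewrite -/(laplace p f r) -/(laplace p (grad_sqr f) t).
  have -> : expect p (fun x => r * f x * expR (r * f x)) = r * laplace_deriv p f r.
    by rewrite -expectZ; apply: eq_bigr => x _; rewrite !mulrA.
  have le2 : 2 * (C * expect p (fun x => upper_grad_sqr (fun y => r * f y) x *
      expR (r * f x))) <= expect p (fun x => t * grad_sqr f x * expR (r * f x)).
    rewrite -!expectZ; apply: le_expect => // x; rewrite upper_grad_sqrZ//.
    have := ler_wpM2r (expR_ge0 (r * f x)) (upper_grad_sqr_le f x).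
    move/(ler_wpM2l (sqr_ge0 r))/(ler_wpM2l (ltW C_gt0)); rewrite /t; lra.
  have Z_gt0 : 0 < laplace p f r by exact: laplace_gt0.
  have := ler_wpM2l (ltW Z_gt0) lnW; move: le2.
  rewrite mul0r add0r /t; lra.
have K_ge0 : 0 <= 16 * C * M.
  by apply: mulr_ge0; [rewrite mulr_ge0 ?(ltW C_gt0)|exact: mean_grad_sqr_ge0].
have := herbst_argument p_ge0 p_sum1 (lexx 0) K_ge0 step.
by move=> /(_ s); rewrite s_gt0 lexx => /(_ isT); rewrite mul0r subr0 mulr1.
Qed.

(** The exponential Markov inequality. *)
Lemma upper_tail (s t : R) : 0 < s -> 16 * C * L * s <= 1 ->
  prob p (fun x => t < f x - expect p f) <= expR (- (s * t) + 16 * C * M * s ^+ 2).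
Proof.
move=> s_gt0 s_le.
apply: (@le_trans _ _ (expR (- (s * t) - s * expect p f) * laplace p f s)).
  rewrite /laplace /expect mulr_sumr /prob big_mkcond/=; apply: ler_sum => x _.
  case: ifP => [tx|_]; last by rewrite !mulr_ge0 ?expR_ge0.
  rewrite mulrCA -expRD -[leLHS]mulr1; apply: ler_wpM2l => //.
  rewrite -expR0 ler_expR; have := ltW tx.
  by rewrite -(ler_pM2l s_gt0) /expect; lra.
rewrite -[laplace p f s]lnK ?posrE ?laplace_gt0// -expRD ler_expR.
have := ln_laplace_le_second_order s_gt0 s_le; lra.
Qed.

End Tail.

Lemma DN i (f : config n -> R) : D i (fun x => - f x) = fun x => - D i f x.
Proof. by apply/funext => x; rewrite /D -mulNr; congr (_ / _); ring. Qed.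

Lemma expectN (f : config n -> R) : expect p (fun x => - f x) = - expect p f.
Proof. by rewrite -mulN1r -expectZ; apply: eq_bigr => x _; rewrite mulN1r. Qed.

Lemma second_order_tail (f : config n -> R) (L s t : R) : 0 <= L ->
  (forall x, \sum_i (\sum_j D i (D j f) x * D j f x) ^+ 2 <=
    L ^+ 2 * grad_sqr f x) ->
  0 < s -> 16 * C * L * s <= 1 ->
  prob p (fun x => t < `|f x - expect p f|) <=
  2 * expR (- (s * t) + 16 * C * expect p (grad_sqr f) * s ^+ 2).
Proof.
move=> L_ge0 hess s_gt0 s_le.
have above := upper_tail L_ge0 hess t s_gt0 s_le.
have gN : grad_sqr (fun x => - f x) = grad_sqr f.
  by apply/funext => x; apply: eq_bigr => j _; rewrite DN sqrrN.
have hessN x : \sum_i (\sum_j D i (D j (fun x => - f x)) x *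
    D j (fun x => - f x) x) ^+ 2 <= L ^+ 2 * grad_sqr (fun x => - f x) x.
  rewrite gN; apply: le_trans (hess x); rewrite le_eqVlt; apply/orP; left; apply/eqP.
  apply: eq_bigr => i _; congr (_ ^+ 2); apply: eq_bigr => j _.
  by rewrite !DN mulrNN.
have below := upper_tail L_ge0 hessN t s_gt0 s_le.
rewrite gN expectN in below.
rewrite mulr_natl mulr2n; apply: le_trans (lerD above below).
rewrite /prob [leLHS]big_mkcond [X in _ <= X + _]big_mkcond [X in _ <= _ + X]big_mkcond.
rewrite -big_split/=; apply: ler_sum => x _; have px := p_ge0 x.
rewrite -opprD ltr_normr.
by case: (t < f x - _); case: (t < - _) => /=; lra.
Qed.

Context (C0 : R).
Hypothesis C0_ge0 : 0 <= C0.
Hypothesis poincare : forall g : config n -> R,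
  expect p (fun x => g x ^+ 2) - expect p g ^+ 2 <=
  C0 * \sum_j expect p (fun x => D j g x ^+ 2).

(** The Poincare inequality is applied to each partial derivative, whose own
derivatives are the entries of the Hessian. *)
Lemma mean_grad_sqr_le (f : config n -> R) :
  expect p (grad_sqr f) <=
  norm2 (expect_gradient p f) ^+ 2 + C0 * max_hessian_frobenius_sq f.
Proof.
have -> : expect p (grad_sqr f) = \sum_j expect p (fun x => D j f x ^+ 2).
  rewrite /expect /grad_sqr exchange_big/=; apply: eq_bigr => x _.
  by rewrite mulr_sumr.
apply: (@le_trans _ _ (\sum_j (expect p (D j f) ^+ 2 +
    C0 * \sum_i expect p (fun x => D i (D j f) x ^+ 2)))).
  by apply: ler_sum => j _; rewrite -lerBlDl; exact: poincare.
rewrite big_split/= -mulr_sumr; apply: lerD.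
  rewrite sqr_norm2 le_eqVlt; apply/orP; left; apply/eqP.
  apply: eq_bigr => j _; rewrite mxE; congr (_ ^+ 2).
  by apply: eq_bigr => x _; rewrite mxE.
apply: ler_wpM2l => //.
have -> : \sum_j \sum_i expect p (fun x => D i (D j f) x ^+ 2) =
    expect p (fun x => frobenius_norm (hessian f x) ^+ 2).
  rewrite exchange_big/= /expect; under eq_bigr do rewrite exchange_big/=.
  rewrite exchange_big/=; apply: eq_bigr => x _; rewrite sqr_sqrtr; last first.
    by apply: sumr_ge0 => i _; apply: sumr_ge0 => j _; exact: sqr_ge0.
  rewrite mulr_sumr; apply: eq_bigr => i _; rewrite mulr_sumr.
  by apply: eq_bigr => j _; rewrite mxE.
rewrite -[leRHS]mul1r -p_sum1 mulr_suml; apply: ler_sum => x _.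
apply: ler_wpM2l => //; exact: (le_bigmax _ (fun x => frobenius_norm (hessian f x) ^+ 2)).
Qed.

End SecondOrder.

Lemma hessian_gradient_le (R : realType) (n : nat) (f : config n -> R) x :
  \sum_i (\sum_j D i (D j f) x * D j f x) ^+ 2 <=
  max_hessian_spectral f ^+ 2 * grad_sqr f x.
Proof.
have -> : \sum_i (\sum_j D i (D j f) x * D j f x) ^+ 2 =
    norm2 (hessian f x *m gradient f x) ^+ 2.
  rewrite sqr_norm2; apply: eq_bigr => i _; rewrite mxE; congr (_ ^+ 2).
  by apply: eq_bigr => j _; rewrite !mxE.
have -> : grad_sqr f x = norm2 (gradient f x) ^+ 2.
  by rewrite sqr_norm2; apply: eq_bigr => j _; rewrite mxE.
have L0 : 0 <= max_hessian_spectral f by exact: bigmax_ge_id.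
rewrite -exprMn ler_pXn2r ?nnegrE ?mulr_ge0 ?norm2_ge0//.
apply: le_trans (norm2_mulmx_le _ _) _; apply: ler_wpM2r; first exact: norm2_ge0.
exact: (le_bigmax _ (fun x => spectral_norm (hessian f x))).
Qed.

(** The exponent is minimized at [s = t / (2 * K * V)] if this is admissible, and
otherwise [s = 1 / (K * L)] is taken. With [V = 0] or [L = 0] one constraint
disappears, in agreement with a quotient equal to [+oo]; when both vanish,
[s] is arbitrary and [q] must be zero. *)
Lemma optimize_tail (R : realType) (K V L t q : R) :
  0 < K -> 0 <= V -> 0 <= L -> 0 < t -> 0 <= q ->
  (forall s, 0 < s -> K * L * s <= 1 -> q <= 2 * expR (- (s * t) + K * V * s ^+ 2)) ->
  (q%:E <= 2%:E * expeR (- ((1 / (4 * K))%:E *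
    Order.min ((t ^+ 2)%:E / V%:E) (t%:E / L%:E))))%E.
Proof.
move=> K0 V0 L0 t0 q0 H; set c := 1 / (4 * K).
have c0 : 0 < c by rewrite divr_gt0// mulr_gt0.
have t2 : (0 < (t ^+ 2)%:E)%E by rewrite lte_fin exprn_gt0.
have t1 : (0 < t%:E)%E by rewrite lte_fin.
have fin (m s : R) : 0 < s -> K * L * s <= 1 -> c * m <= s * t - K * V * s ^+ 2 ->
    (q%:E <= 2%:E * expeR (- (c%:E * m%:E)))%E.
  move=> s0 sL cm; rewrite /= lee_fin.
  apply: le_trans (H s s0 sL) _; rewrite ler_pM2l// ler_expR; lra.
rewrite !inver; have [V_eq|V_neq] := eqVneq V 0; have [L_eq|L_neq] := eqVneq L 0.
- rewrite !gt0_muley//= mule0 lee_fin.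
  rewrite leNgt; apply/negP => q_gt0.
  (* At s * t = 2 / q the bound reads q <= 2 * expR (- (2 / q)) < q. *)
  have s0 : 0 < 2 / q / t by rewrite !divr_gt0.
  have := H _ s0; rewrite L_eq V_eq !mulr0 !mul0r addr0 divfK ?gt_eqF// ler01.
  move=> /(_ isT); rewrite leNgt => /negP; apply.
  rewrite expRN ltr_pdivrMr ?expR_gt0//.
  have := expR_ge1Dx (2 / q) => /(ler_wpM2l q0).
  by rewrite mulrDr mulr1 mulrCA divff ?gt_eqF// mulr1; lra.
- have L_gt0 : 0 < L by rewrite lt_neqAle eq_sym L_neq.
  rewrite gt0_muley// minye -EFinM; apply: (fin _ (1 / (K * L))).
  + by rewrite divr_gt0// mulr_gt0.
  + by rewrite mulrC divfK// gt_eqF// mulr_gt0.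
  + rewrite V_eq mulr0 mul0r subr0 /c -subr_ge0.
    rewrite (_ : _ - _ = 3 * t / (4 * K * L)); last by field; rewrite !gt_eqF.
    by rewrite divr_ge0 ?mulr_ge0 ?ltW.
- have V_gt0 : 0 < V by rewrite lt_neqAle eq_sym V_neq.
  rewrite [(t%:E * +oo)%E]gt0_muley// miney -EFinM; apply: (fin _ (t / (2 * K * V))).
  + by rewrite divr_gt0// !mulr_gt0.
  + by rewrite L_eq mulr0 mul0r.
  + by rewrite le_eqVlt; apply/orP; left; apply/eqP; rewrite /c; field; rewrite !gt_eqF.
have V_gt0 : 0 < V by rewrite lt_neqAle eq_sym V_neq.
have L_gt0 : 0 < L by rewrite lt_neqAle eq_sym L_neq.
rewrite -!EFinM -EFin_min.
have m1 : Num.min (t ^+ 2 / V) (t / L) <= t ^+ 2 / V by rewrite ge_min lexx.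
have m2 : Num.min (t ^+ 2 / V) (t / L) <= t / L by rewrite ge_min lexx orbT.
have [le|/ltW le] := leP (t / (2 * K * V)) (1 / (K * L)).
- apply: (fin _ (t / (2 * K * V))).
  + by rewrite divr_gt0// !mulr_gt0.
  + rewrite mulrC -ler_pdivlMr ?mulr_gt0//.
  + apply: le_trans (ler_wpM2l (ltW c0) m1) _.
    by rewrite le_eqVlt; apply/orP; left; apply/eqP; rewrite /c; field; rewrite !gt_eqF.
- apply: (fin _ (1 / (K * L))).
  + by rewrite divr_gt0// mulr_gt0.
  + by rewrite mulrC divfK// gt_eqF// mulr_gt0.
  + apply: le_trans (ler_wpM2l (ltW c0) m2) _.
    set s := 1 / (K * L) in le *.
    have s0 : 0 < s by rewrite divr_gt0// mulr_gt0.
    have : K * V * s ^+ 2 <= s * t / 2.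
      move: le; rewrite ler_pdivlMr ?mulr_gt0// => /(ler_wpM2r (ltW s0)).
      by rewrite -(@ler_pM2l _ 2)//; lra.
    have -> : c * (t / L) = s * t / 4 by rewrite /c /s; field; rewrite !gt_eqF.
    have := mulr_gt0 s0 t0; lra.
Qed.

Theorem theorem3 (R : realType) (alpha gamma : R)
  (alpha_lt1 : alpha < 1) (gamma_gt0 : 0 < gamma) :
  exists2 c : R, 0 < c &
    forall (n : nat) (J : 'M[R]_n) (h : 'cV[R]_n),
      J^T = J ->
      (forall i : 'I_n, J i i = 0) ->
      inf_norm J = alpha ->
      (forall (i : 'I_n) (x : config n), gamma <= ising_cond_var J h i x) ->
      forall (f : config n -> R) (t : R), 0 < t ->
        let P := ising J h in
        ((prob P (fun x => t < `|f x - expect P f|))%:E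
         <= 2%:E * expeR (- (c%:E * Order.min
              ((t ^+ 2)%:E / (norm2 (expect_gradient P f) ^+ 2
                              + max_hessian_frobenius_sq f)%:E)
              (t%:E / (max_hessian_spectral f)%:E))))%E.
Proof.
pose C0 := (gamma * (1 - alpha) ^+ 2)^-1.
have C0_gt0 : 0 < C0 by rewrite invr_gt0 mulr_gt0// exprn_gt0// subr_gt0.
(* 4 * C0 is the log-Sobolev constant and C0 the Poincare constant; the factor
   1 + C0 dominates both coefficients of the bound on the mean squared gradient. *)
pose K := 16 * (4 * C0) * (1 + C0).
have K_gt0 : 0 < K by rewrite !mulr_gt0// addr_gt0.
exists (1 / (4 * K)); first by rewrite divr_gt0// mulr_gt0.
move=> n J h J_sym J_diag J_norm var_ge f t t_gt0; cbv zeta; set P := ising J h.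
have P_ge0 x : 0 <= P x by rewrite ltW// ising_gt0.
have P_sum1 : \sum_x P x = 1 by exact: ising_sum1.
have J_lt1 : inf_norm J < 1 by rewrite J_norm.
have lsi := ising_log_sobolev J_sym J_diag gamma_gt0 J_lt1 var_ge.
have poi := ising_poincare J_sym J_diag gamma_gt0 J_lt1 var_ge.
rewrite J_norm -/C0 in lsi poi.
have L_ge0 : 0 <= max_hessian_spectral f by exact: bigmax_ge_id.
have F_ge0 : 0 <= max_hessian_frobenius_sq f by exact: bigmax_ge_id.
have N_ge0 : 0 <= norm2 (expect_gradient P f) ^+ 2 by exact: sqr_ge0.
have C_gt0 : 0 < 4 * C0 by rewrite mulr_gt0.
apply: optimize_tail => //; [exact: addr_ge0|exact: sumr_ge0|move=> s s_gt0 s_le].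
have L_le : 16 * (4 * C0) * max_hessian_spectral f * s <= 1.
  apply: le_trans s_le; rewrite ler_pM2r// ler_wpM2r// /K.
  rewrite ler_peMr ?lerDl ?(ltW C0_gt0)// mulr_ge0// ltW//.
apply: le_trans (second_order_tail P_ge0 P_sum1 C_gt0 lsi t L_ge0
  (hessian_gradient_le f) s_gt0 L_le) _.
rewrite ler_pM2l// ler_expR lerD2l; apply: ler_wpM2r; first exact: sqr_ge0.
rewrite /K -[leRHS]mulrA; apply: ler_wpM2l; first by rewrite mulr_ge0// ltW.
apply: le_trans (mean_grad_sqr_le P_ge0 P_sum1 (ltW C0_gt0) poi f) _.
have := mulr_ge0 (ltW C0_gt0) N_ge0; lra.
Qed.
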